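(* Let $\mathcal{C}$ be a weakly fiat $2$-category over an algebraically closed field and let $C$ be a coalgebra $1$-morphism in $\underline{\mathcal{C}}$. For a $\mathcal{C}$-stable, subobject-closed, quotient-closed full subcategory $\mathcal{S}$ of $\mathrm{comod}_{\underline{\mathcal{C}}}(C)$, let $i$ be the embedding of $\mathcal{S}$ into $\mathrm{comod}_{\underline{\mathcal{C}}}(C)$ and $p$ its right adjoint. Then the assignment $$\mathcal{S}\longmapsto [ip(C),ip(C)],$$ where $[ip(C),ip(C)]$ is regarded as a subcoalgebra of $C$, induces a bijection between the set of $\mathcal{C}$-stable subobject-closed quotient-closed full subcategories of $\mathrm{comod}_{\underline{\mathcal{C}}}(C)$ up to equivalence and the set of subcoalgebras of $C$ up to isomorphism.
   Context: A $\Bbbk$-linear category ($\Bbbk$ an algebraically closed field) is finitary if it is additive, idempotent complete, has finitely many isomorphism classes of indecomposable objects and finite-dimensional morphism spaces. A finitary $2$-category $\mathcal{C}$ has finitely many objects, finitary $\Bbbk$-linear morphism categories, biadditive and bilinear horizontal composition, and indecomposable identity $1$-morphisms $\mathbb{1}_{\mathtt{i}}$. It is weakly fiat if it has a weak anti-equivalence $(-)^*$ reversing the direction of $1$- and $2$-morphisms such that $(F,F^* )$ is an adjoint pair for each $1$-morphism $F$. Horizontal and vertical composition are $\circ_0,\circ_1$; horizontal composition of $1$-morphisms is written by juxtaposition (non-composable composites being zero). $\underline{\mathcal{C}}$ is the injective abelianisation of $\mathcal{C}$: each $\underline{\mathcal{C}}(\mathtt{i},\mathtt{j})$ is the abelian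 category with enough injectives in which $\mathcal{C}(\mathtt{i},\mathtt{j})$ is (up to equivalence) the full subcategory of injective objects. Horizontal composition extends to $\underline{\mathcal{C}}$ and is left exact in both variables. A coalgebra $1$-morphism $C$ in $\underline{\mathcal{C}}$ is a coalgebra object in $\coprod_{\mathtt{i}}\underline{\mathcal{C}}(\mathtt{i},\mathtt{i})$, i.e. a direct sum of $1$-morphisms there with $2$-morphisms $\mu_C:C\to CC$, $\varepsilon_C:C\to\mathbb{1}=\bigoplus_{\mathtt{i}}\mathbb{1}_{\mathtt{i}}$ satisfying coassociativity and counitality. A right $C$-comodule is a $1$-morphism $M$ of $\underline{\mathcal{C}}$ with a coassociative, counital $\rho_M:M\to MC$. $\mathrm{comod}_{\underline{\mathcal{C}}}(C)$ is the category of right $C$-comodules in $\underline{\mathcal{C}}$, on which $\mathcal{C}$ acts by left composition, $M\mapsto FM$. A full subcategory is $\mathcal{C}$-stable if it is closed under this action, i.e. contains $FM$ for all its objects $M$ and all $1$-morphisms $F$ of $\mathcal{C}$. Full subcategories are understood to be closed under finite direct sums. Internal hom. For $N\in\mathrm{comod}_{\underline{\mathcal{C}}}(C)$, $[N,-]:\mathrm{comod}_{\underline{\mathcal{C}}}(C)\to\underline{\mathcal{C}}$ is defined by natural isomorphisms $\mathrm{Hom}(M,FN)\cong\mathrm{Hom}_{\underline{\mathcal{C}}}([N,M],F)$ for $F\in\underline{\mathcal{C}}$; $\mathrm{coev}_{N,M}:M\to[N,M]N$ corresponds to $\mathrm{id}_{[N,M]}$. $[N,N]$ is a coalgebra $1$-morphism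 with counit corresponding to $\mathrm{id}_N$ and comultiplication corresponding to $(\mathrm{id}_{[N,N]}\circ_0\mathrm{coev}_{N,N})\circ_1\mathrm{coev}_{N,N}$. There is an isomorphism $[C,-]\cong\mathrm{Id}$ on $\mathrm{comod}_{\underline{\mathcal{C}}}(C)$, in particular $[C,C]\cong C$. A subcoalgebra of $C$ is a coalgebra $1$-morphism $D$ with a monomorphism $\iota:D\hookrightarrow C$ in $\underline{\mathcal{C}}$ such that $\mu_C\circ_1\iota=(\iota\circ_0\iota)\circ_1\mu_D$ and $\varepsilon_D=\varepsilon_C\circ_1\iota$. The subcoalgebra structure on $[B,B]$ for $B=ip(C)$: let $\iota':B\hookrightarrow C$ be the counit of the adjunction $(i,p)$ at $C$ (a monomorphism of comodules). The map $[\iota',B]:[C,B]\to[B,B]$ is an isomorphism, and the embedding is $[C,\iota']\circ_1[\iota',B]^{-1}:[B,B]\to[C,C]\cong C$. ''Up to equivalence'' of full subcategories and ''up to isomorphism'' of subcoalgebras are understood compatibly with the embeddings into $\mathrm{comod}_{\underline{\mathcal{C}}}(C)$ and $C$, respectively. *)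

(* Defs.v *)
From HB Require Import structures.
From mathcomp Require Import all_boot all_order all_algebra.
From Stdlib Require Import FunctionalExtensionality ProofIrrelevance.

Set Implicit Arguments.
Unset Strict Implicit.
Unset Printing Implicit Defensive.

Import GRing.Theory.
Local Open Scope ring_scope.

Declare Scope bicat_scope.
Local Open Scope bicat_scope.
Reserved Notation "g ∘ f" (at level 50, left associativity).
Reserved Notation "G ⊙ F" (at level 40, left associativity).
Reserved Notation "b ⊛ a" (at level 40, left associativity).

Record cat := Cat {
  ob :> Type;
  hom : ob -> ob -> Type;
  idm : forall x, hom x x;
  comp : forall x y z, hom y z -> hom x y -> hom x z;
  comp1m : forall x y (f : hom x y), comp (idm y) f = f;
  compm1 : forall x y (f : hom x y), comp f (idm x) = f;
  compA : forall x y z w (h : hom z w) (g : hom y z) (f : hom x y),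
    comp h (comp g f) = comp (comp h g) f }.

Arguments hom {c} x y.
Arguments idm {c} x.
Notation "g ∘ f" := (comp g f) : bicat_scope.

Section CatNotions.
Variable X : cat.
Implicit Types x y z w : X.

Definition inverse_pair x y (f : hom x y) (g : hom y x) : Prop :=
  g ∘ f = idm x /\ f ∘ g = idm y.
Definition is_iso x y (f : hom x y) : Prop := exists g, inverse_pair f g.
Definition isomorphic x y : Prop := exists f : hom x y, is_iso f.
Definition is_mono x y (f : hom x y) : Prop :=
  forall w (g h : hom w x), f ∘ g = f ∘ h -> g = h.
Definition is_epi x y (f : hom x y) : Prop :=
  forall w (g h : hom y w), g ∘ f = h ∘ f -> g = h.
Definition is_zero x : Prop :=
  (forall y, exists! f : hom x y, True) /\ (forall y, exists! f : hom y x, True).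
Definition is_coproduct x y z (a : hom x z) (b : hom y z) : Prop :=
  forall w (f : hom x w) (g : hom y w), exists! h : hom z w, h ∘ a = f /\ h ∘ b = g.
(* In the categories below, which are preadditive, coproducts are the same as
   biproducts. *)
Definition is_direct_sum x y z : Prop :=
  exists (a : hom x z) (b : hom y z), is_coproduct a b.
Definition indecomposable x : Prop :=
  ~ is_zero x /\ (forall y z, is_direct_sum y z x -> is_zero y \/ is_zero z).
Definition is_injective x : Prop :=
  forall y z (m : hom y z) (f : hom y x), is_mono m -> exists g : hom z x, g ∘ m = f.
Definition enough_injectives : Prop :=
  forall x, exists y (m : hom x y), is_injective y /\ is_mono m.
Definition idempotent_complete : Prop :=
  forall x (e : hom x x), e ∘ e = e ->
  exists y (r : hom x y) (s : hom y x), s ∘ r = e /\ r ∘ s = idm y.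

Definition eq_hom x y (e : x = y) : hom x y :=
  match e in _ = z return hom x z with erefl => idm x end.

End CatNotions.

Record functor (X Y : cat) := Functor {
  fob :> X -> Y;
  fmap : forall x y, hom x y -> hom (fob x) (fob y);
  fmap1 : forall x, fmap (idm x) = idm (fob x);
  fmapM : forall x y z (g : hom y z) (f : hom x y),
    fmap (g ∘ f) = fmap g ∘ fmap f }.
Arguments fmap {X Y} _ {x y} _.

Definition idF (X : cat) : functor X X.
Proof. by exists id (fun _ _ f => f). Defined.

Definition compF (X Y Z : cat) (G : functor Y Z) (F : functor X Y) : functor X Z.
Proof.
exists (fun x => G (F x)) (fun _ _ f => fmap G (fmap F f)).
- by move=> x; rewrite !fmap1.
- by move=> x y z g f; rewrite !fmapM.
Defined.

Definition natural (X Y : cat) (F G : functor X Y)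
    (t : forall x, hom (F x) (G x)) : Prop :=
  forall x y (f : hom x y), t y ∘ fmap F f = fmap G f ∘ t x.

Definition nat_isomorphic (X Y : cat) (F G : functor X Y) : Prop :=
  exists t : forall x, hom (F x) (G x), natural t /\ (forall x, is_iso (t x)).

Definition is_equivalence (X Y : cat) (F : functor X Y) : Prop :=
  exists G : functor Y X,
    nat_isomorphic (compF G F) (idF X) /\ nat_isomorphic (compF F G) (idF Y).

Definition fully_faithful (X Y : cat) (F : functor X Y) : Prop :=
  forall x y, bijective (@fmap X Y F x y).

Record adjunction (X Y : cat) (L : functor X Y) (R : functor Y X) := Adjunction {
  adj_unit : forall x : X, hom x (R (L x));
  adj_counit : forall y : Y, hom (L (R y)) y;
  adj_unit_nat : natural (F := idF X) (G := compF R L) adj_unit;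
  adj_counit_nat : natural (F := compF L R) (G := idF Y) adj_counit;
  adj_triangleL : forall x, adj_counit (L x) ∘ fmap L (adj_unit x) = idm (L x);
  adj_triangleR : forall y, fmap R (adj_counit y) ∘ adj_unit (R y) = idm (R y) }.

Definition fullsub (X : cat) (P : X -> Prop) : cat.
Proof.
exists {x : X | P x} (fun x y => @hom X (sval x) (sval y))
  (fun x => idm (sval x)) (fun x y z g f => g ∘ f).
- by move=> x y f; apply: comp1m.
- by move=> x y f; apply: compm1.
- by move=> x y z w h g f; apply: compA.
Defined.

Definition incl (X : cat) (P : X -> Prop) : functor (fullsub P) X.
Proof. by exists (fun x : fullsub P => sval x) (fun _ _ f => f). Defined.

Definition prod_cat (I : Type) (X : I -> cat) : cat.
Proof.
exists (forall i, X i) (fun x y => forall i, hom (x i) (y i))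
  (fun x i => idm (x i)) (fun x y z g f i => g i ∘ f i).
- by move=> x y f; apply: functional_extensionality_dep => i; apply: comp1m.
- by move=> x y f; apply: functional_extensionality_dep => i; apply: compm1.
- by move=> x y z w h g f; apply: functional_extensionality_dep => i; apply: compA.
Defined.

(* Morphism spaces are [vectType]s, i.e. finite-dimensional. *)
Record lincat (k : fieldType) := LinCat {
  lob : Type;
  lhom : lob -> lob -> vectType k;
  lid : forall x, lhom x x;
  lcomp : forall x y z, lhom y z -> lhom x y -> lhom x z;
  lcomp1m : forall x y (f : lhom x y), lcomp (lid y) f = f;
  lcompm1 : forall x y (f : lhom x y), lcomp f (lid x) = f;
  lcompA : forall x y z w (h : lhom z w) (g : lhom y z) (f : lhom x y),
    lcomp h (lcomp g f) = lcomp (lcomp h g) f;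
  lcomp_linr : forall x y z (g : lhom y z), linear (lcomp g : lhom x y -> lhom x z);
  lcomp_linl : forall x y z (f : lhom x y),
    linear ((fun g => lcomp g f) : lhom y z -> lhom x z) }.
Arguments lhom {k} _ _ _.

Coercion lcat (k : fieldType) (A : lincat k) : cat :=
  Cat (@lcomp1m k A) (@lcompm1 k A) (@lcompA k A).

Section LinCatNotions.
Variables (k : fieldType) (A : lincat k).
Implicit Types x y z w : A.

Definition zerom x y : hom x y := 0 : lhom A x y.

Definition is_kernel x y z (m : hom z x) (f : hom x y) : Prop :=
  f ∘ m = zerom z y /\
  forall w (g : hom w x), f ∘ g = zerom w y -> exists! h : hom w z, m ∘ h = g.
Definition is_cokernel x y z (e : hom y z) (f : hom x y) : Prop :=
  e ∘ f = zerom x z /\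
  forall w (g : hom y w), g ∘ f = zerom x w -> exists! h : hom z w, h ∘ e = g.

Definition additive : Prop :=
  (exists z : A, is_zero z) /\ (forall x y, exists z, is_direct_sum x y z).

Definition finitary : Prop :=
  [/\ additive, idempotent_complete A &
      exists (n : nat) (Y : 'I_n -> A),
        forall x, indecomposable x -> exists a, isomorphic x (Y a)].

Record abelian : Prop := Abelian {
  ab_additive : additive;
  ab_ker : forall x y (f : hom x y), exists z (m : hom z x), is_kernel m f;
  ab_coker : forall x y (f : hom x y), exists z (e : hom y z), is_cokernel e f;
  ab_mono : forall x y (m : hom x y), is_mono m ->
    exists z (f : hom y z), is_kernel m f;
  ab_epi : forall x y (e : hom x y), is_epi e ->
    exists z (f : hom z x), is_cokernel e f }.

End LinCatNotions.

Definition linear_functor (k : fieldType) (A B : lincat k) (F : functor A B) : Prop :=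
  forall x y : A, linear (@fmap _ _ F x y : lhom A x y -> lhom B (F x) (F y)).

Definition op_lincat (k : fieldType) (A : lincat k) : lincat k.
Proof.
exists (lob A) (fun x y => lhom A y x) (@lid k A) (fun x y z g f => lcomp f g).
- by move=> x y f; apply: lcompm1.
- by move=> x y f; apply: lcomp1m.
- by move=> x y z w h g f; rewrite lcompA.
- by move=> x y z g; apply: lcomp_linl.
- by move=> x y z f; apply: lcomp_linr.
Defined.

(* [I] is the set of objects, [G ⊙ F] is horizontal composition of 1-morphisms
   (first [F], then [G]), [b ⊛ a] horizontal composition of 2-morphisms, and
   [∘] vertical composition. *)
Record bicat (k : fieldType) (I : Type) := Bicat {
  hcat :> I -> I -> lincat k;
  hc : forall i j l, hcat j l -> hcat i j -> hcat i l;
  hcm : forall i j l (G G' : hcat j l) (F F' : hcat i j),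
    hom G G' -> hom F F' -> hom (hc G F) (hc G' F');
  hcm1 : forall i j l (G : hcat j l) (F : hcat i j),
    hcm (idm G) (idm F) = idm (hc G F);
  hcmM : forall i j l (G G' G'' : hcat j l) (F F' F'' : hcat i j)
      (b' : hom G' G'') (b : hom G G') (a' : hom F' F'') (a : hom F F'),
    hcm (b' ∘ b) (a' ∘ a) = hcm b' a' ∘ hcm b a;
  hcm_linr : forall i j l (G G' : hcat j l) (F F' : hcat i j) (b : hom G G'),
    linear (hcm b : lhom _ F F' -> lhom _ (hc G F) (hc G' F'));
  hcm_linl : forall i j l (G G' : hcat j l) (F F' : hcat i j) (a : hom F F'),
    linear ((fun b => hcm b a) : lhom _ G G' -> lhom _ (hc G F) (hc G' F'));
  one : forall i, hcat i i;
  asso : forall i j l m (H : hcat l m) (G : hcat j l) (F : hcat i j),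
    hom (hc (hc H G) F) (hc H (hc G F));
  assoV : forall i j l m (H : hcat l m) (G : hcat j l) (F : hcat i j),
    hom (hc H (hc G F)) (hc (hc H G) F);
  assoK : forall i j l m (H : hcat l m) (G : hcat j l) (F : hcat i j),
    inverse_pair (asso H G F) (assoV H G F);
  asso_nat : forall i j l m (H H' : hcat l m) (G G' : hcat j l) (F F' : hcat i j)
      (c : hom H H') (b : hom G G') (a : hom F F'),
    asso H' G' F' ∘ hcm (hcm c b) a = hcm c (hcm b a) ∘ asso H G F;
  lu : forall i j (F : hcat i j), hom (hc (one j) F) F;
  luV : forall i j (F : hcat i j), hom F (hc (one j) F);
  luK : forall i j (F : hcat i j), inverse_pair (lu F) (luV F);
  lu_nat : forall i j (F F' : hcat i j) (a : hom F F'),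
    lu F' ∘ hcm (idm (one j)) a = a ∘ lu F;
  ru : forall i j (F : hcat i j), hom (hc F (one i)) F;
  ruV : forall i j (F : hcat i j), hom F (hc F (one i));
  ruK : forall i j (F : hcat i j), inverse_pair (ru F) (ruV F);
  ru_nat : forall i j (F F' : hcat i j) (a : hom F F'),
    ru F' ∘ hcm a (idm (one i)) = a ∘ ru F;
  triangle : forall i j l (G : hcat j l) (F : hcat i j),
    hcm (idm G) (lu F) ∘ asso G (one j) F = hcm (ru G) (idm F);
  pentagon : forall i j l m n (K : hcat m n) (H : hcat l m) (G : hcat j l)
      (F : hcat i j),
    asso K H (hc G F) ∘ asso (hc K H) G F =
    hcm (idm K) (asso H G F) ∘ asso K (hc H G) F ∘ hcm (asso K H G) (idm F) }.

Arguments one {k I} _ _.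
Notation "G ⊙ F" := (hc G F) : bicat_scope.
Notation "b ⊛ a" := (hcm b a) : bicat_scope.

Lemma inverse_pair_epi (X : cat) (x y z : X) (f : hom x y) (g : hom y x)
    (a b : hom y z) :
  inverse_pair f g -> a ∘ f = b ∘ f -> a = b.
Proof. by case=> _ e ab; rewrite -[a]compm1 -[b]compm1 -e !compA ab. Qed.

Lemma inverse_pair_mono (X : cat) (x y z : X) (f : hom x y) (g : hom y x)
    (a b : hom z x) :
  inverse_pair f g -> f ∘ a = f ∘ b -> a = b.
Proof. by case=> e _ ab; rewrite -[a]comp1m -[b]comp1m -e -!compA ab. Qed.

Section BicatNotions.
Variables (k : fieldType) (I : Type) (B : bicat k I).

Record is_2category : Prop := Is2Category {
  strict_asso : forall i j l m (H : B l m) (G : B j l) (F : B i j),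
    exists e : (H ⊙ G) ⊙ F = H ⊙ (G ⊙ F), asso H G F = eq_hom e;
  strict_lu : forall i j (F : B i j), exists e : one B j ⊙ F = F, lu F = eq_hom e;
  strict_ru : forall i j (F : B i j), exists e : F ⊙ one B i = F, ru F = eq_hom e }.

Definition adjoint_pair (i j : I) (F : B i j) (G : B j i) : Prop :=
  exists (eta : hom (one B i) (G ⊙ F)) (eps : hom (F ⊙ G) (one B j)),
    lu F ∘ (eps ⊛ idm F) ∘ assoV F G F ∘ (idm F ⊛ eta) ∘ ruV F = idm F /\
    ru G ∘ (idm G ⊛ eps) ∘ asso G F G ∘ (eta ⊛ idm G) ∘ luV G = idm G.

Lemma asso_asV (i j l m : I) (H : B l m) (G : B j l) (F : B i j) :
  asso H G F ∘ assoV H G F = idm _.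
Proof. by case: (assoK H G F). Qed.

Lemma assoV_as (i j l m : I) (H : B l m) (G : B j l) (F : B i j) :
  assoV H G F ∘ asso H G F = idm _.
Proof. by case: (assoK H G F). Qed.

Lemma assoV_nat (i j l m : I) (H H' : B l m) (G G' : B j l) (F F' : B i j)
    (c : hom H H') (b : hom G G') (a : hom F F') :
  assoV H' G' F' ∘ (c ⊛ (b ⊛ a)) = ((c ⊛ b) ⊛ a) ∘ assoV H G F.
Proof.
rewrite -[LHS]compm1 -asso_asV compA -(compA (assoV _ _ _)) -asso_nat compA.
by rewrite assoV_as comp1m.
Qed.

Lemma hcm_comp_l (i j l : I) (G G' G'' : B j l) (F : B i j)
    (b' : hom G' G'') (b : hom G G') :
  (b' ∘ b) ⊛ idm F = (b' ⊛ idm F) ∘ (b ⊛ idm F).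
Proof. by rewrite -hcmM comp1m. Qed.

Lemma hcm_comp_r (i j l : I) (G : B j l) (F F' F'' : B i j)
    (a' : hom F' F'') (a : hom F F') :
  idm G ⊛ (a' ∘ a) = (idm G ⊛ a') ∘ (idm G ⊛ a).
Proof. by rewrite -hcmM comp1m. Qed.

Lemma hcm_exch (i j l : I) (G G' : B j l) (F F' : B i j)
    (b : hom G G') (a : hom F F') :
  (b ⊛ idm F') ∘ (idm G ⊛ a) = (idm G' ⊛ a) ∘ (b ⊛ idm F).
Proof. by rewrite -!hcmM !comp1m !compm1. Qed.

Lemma luV_nat (i j : I) (F F' : B i j) (a : hom F F') :
  luV F' ∘ a = (idm (one B j) ⊛ a) ∘ luV F.
Proof.
have [K K'] := luK F; have [L _] := luK F'.
by rewrite -[RHS]comp1m -L -compA (compA (lu F')) lu_nat -compA K' compm1.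
Qed.

Lemma ruV_nat (i j : I) (F F' : B i j) (a : hom F F') :
  ruV F' ∘ a = (a ⊛ idm (one B i)) ∘ ruV F.
Proof.
have [K K'] := ruK F; have [L _] := ruK F'.
by rewrite -[RHS]comp1m -L -compA (compA (ru F')) ru_nat -compA K' compm1.
Qed.

Lemma triangleV (i j l : I) (G : B j l) (F : B i j) :
  asso G (one B j) F ∘ (ruV G ⊛ idm F) = idm G ⊛ luV F.
Proof.
have [K K'] := ruK G; have [L L'] := luK F.
have e : (idm G ⊛ luV F) ∘ (idm G ⊛ lu F) = idm _ by rewrite -hcm_comp_r L hcm1.
rewrite -[LHS]comp1m -e -compA (compA _ (asso _ _ _)) triangle.
by rewrite -hcm_comp_l K' hcm1 compm1.
Qed.

Lemma hcm_inv_l (i j l : I) (G G' : B j l) (F : B i j) (f : hom G G') (g : hom G' G) :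
  inverse_pair f g -> inverse_pair (f ⊛ idm F) (g ⊛ idm F).
Proof. by case=> e1 e2; split; rewrite -hcm_comp_l ?e1 ?e2 hcm1. Qed.

Lemma pentagonV (i j l m n : I) (K : B m n) (H : B l m) (G : B j l) (F : B i j) :
  asso (K ⊙ H) G F ∘ (assoV K H G ⊛ idm F) ∘ assoV K (H ⊙ G) F =
  assoV K H (G ⊙ F) ∘ (idm K ⊛ asso H G F).
Proof.
apply: (inverse_pair_mono (assoK K H (G ⊙ F))).
rewrite !compA asso_asV comp1m pentagon -!compA.
rewrite (compA (asso K H G ⊛ _)) -hcm_comp_l asso_asV hcm1 comp1m.
by rewrite asso_asV compm1.
Qed.

Lemma hcm_one_inj (i j : I) (F F' : B i j) (a b : hom F F') :
  a ⊛ idm (one B i) = b ⊛ idm (one B i) -> a = b.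
Proof.
by move=> e; apply: (inverse_pair_epi (ruK F)); rewrite -!ru_nat e.
Qed.

Lemma one_hcm_inj (i j : I) (F F' : B i j) (a b : hom F F') :
  idm (one B j) ⊛ a = idm (one B j) ⊛ b -> a = b.
Proof.
by move=> e; apply: (inverse_pair_epi (luK F)); rewrite -!lu_nat e.
Qed.

Lemma ru_hc (i j l : I) (G : B j l) (F : B i j) :
  ru (G ⊙ F) ∘ assoV G F (one B i) = idm G ⊛ ru F.
Proof.
apply: (inverse_pair_epi (assoK G F (one B i))); rewrite -compA assoV_as compm1.
apply: hcm_one_inj; apply: (inverse_pair_mono (assoK G F (one B i))).
rewrite -(triangle (G ⊙ F) (one B i)) hcm_comp_l [RHS]compA asso_nat.
rewrite -(triangle F (one B i)) hcm_comp_r [LHS]compA -hcm1 asso_nat -[LHS]compA.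
by rewrite pentagon !compA.
Qed.

Lemma lu_hc (i j l : I) (G : B j l) (F : B i j) :
  lu (G ⊙ F) ∘ asso (one B l) G F = lu G ⊛ idm F.
Proof.
apply: one_hcm_inj.
apply: (inverse_pair_epi (assoK (one B l) (one B l ⊙ G) F)).
apply: (inverse_pair_epi (hcm_inv_l F (assoK (one B l) (one B l) G))).
rewrite -(asso_nat (idm (one B l)) (lu G) (idm F)).
rewrite -[RHS]compA -hcm_comp_l triangle asso_nat hcm1 -(triangle (one B l) (G ⊙ F)).
by rewrite hcm_comp_r -[RHS]compA pentagon !compA.
Qed.

Lemma assoV_luV (i j l : I) (G : B j l) (F : B i j) :
  assoV (one B l) G F ∘ luV (G ⊙ F) = luV G ⊛ idm F.
Proof.
apply: (inverse_pair_epi (luK (G ⊙ F))).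
have [e1 _] := luK (G ⊙ F); rewrite -compA e1 compm1.
apply: (inverse_pair_epi (assoK (one B l) G F)).
rewrite assoV_as -compA lu_hc -hcm_comp_l.
by have [-> _] := luK G; rewrite hcm1.
Qed.

End BicatNotions.

(* The bicategory with both 1-morphisms and 2-morphisms reversed. *)
Definition coop (k : fieldType) (I : Type) (B : bicat k I) : bicat k I.
Proof.
refine (@Bicat k I (fun i j => op_lincat (B j i))
  (fun i j l G F => (F : B j i) ⊙ (G : B l j))
  (fun i j l G G' F F' b a => (a : @hom (B j i) F' F) ⊛ (b : @hom (B l j) G' G))
  _ _ _ _ (fun i => one B i)
  (fun i j l m H G F => asso (F : B j i) (G : B l j) (H : B m l))
  (fun i j l m H G F => assoV (F : B j i) (G : B l j) (H : B m l))
  _ _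
  (fun i j F => ruV (F : B j i)) (fun i j F => ru (F : B j i)) _ _
  (fun i j F => luV (F : B j i)) (fun i j F => lu (F : B j i)) _ _ _ _).
- move=> i j l G F; exact: (hcm1 (F : B j i) (G : B l j)).
- move=> i j l G G' G'' F F' F'' b' b a' a.
  exact: (@hcmM _ _ B _ _ _ F'' F' F G'' G' G a a' b b').
- move=> i j l G G' F F' b; exact: (@hcm_linl _ _ B l j i F' F G' G b).
- move=> i j l G G' F F' a; exact: (@hcm_linr _ _ B l j i F' F G' G a).
- move=> i j l m H G F; have [e1 e2] := assoK (F : B j i) (G : B l j) (H : B m l).
  by split; [exact: e2 | exact: e1].
- move=> i j l m H H' G G' F F' c b a.
  exact: (esym (@asso_nat _ _ B _ _ _ _ F' F G' G H' H a b c)).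
- move=> i j F; have [e1 e2] := ruK (F : B j i); by split; [exact: e1 | exact: e2].
- move=> i j F F' a; exact: (esym (@ruV_nat _ _ B _ _ F' F a)).
- move=> i j F; have [e1 e2] := luK (F : B j i); by split; [exact: e1 | exact: e2].
- move=> i j F F' a; exact: (esym (@luV_nat _ _ B _ _ F' F a)).
- move=> i j l G F; exact: (@triangleV _ _ B _ _ _ (F : B j i) (G : B l j)).
- move=> i j l m n K H G F.
  have := @pentagon _ _ B _ _ _ _ _ (F : B j i) (G : B l j) (H : B m l) (K : B n m).
  rewrite -compA; exact.
Defined.

Record pseudofunctor (k : fieldType) (I : Type) (B D : bicat k I) := Pseudofunctor {
  pf :> forall i j, functor (B i j) (D i j);
  pf2 : forall i j l (G : B j l) (F : B i j), hom (pf j l G ⊙ pf i j F) (pf i l (G ⊙ F));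
  pf2_iso : forall i j l (G : B j l) (F : B i j), is_iso (pf2 G F);
  pf2_nat : forall i j l (G G' : B j l) (F F' : B i j) (b : hom G G') (a : hom F F'),
    pf2 G' F' ∘ (fmap (pf j l) b ⊛ fmap (pf i j) a) = fmap (pf i l) (b ⊛ a) ∘ pf2 G F;
  pf1 : forall i, hom (one D i) (pf i i (one B i));
  pf1_iso : forall i, is_iso (pf1 i);
  pf_asso : forall i j l m (H : B l m) (G : B j l) (F : B i j),
    fmap (pf i m) (asso H G F) ∘ pf2 (H ⊙ G) F ∘ (pf2 H G ⊛ idm (pf i j F)) =
    pf2 H (G ⊙ F) ∘ (idm (pf l m H) ⊛ pf2 G F) ∘ asso _ _ _;
  pf_lu : forall i j (F : B i j),
    fmap (pf i j) (lu F) ∘ pf2 (one B j) F ∘ (pf1 j ⊛ idm (pf i j F)) = lu (pf i j F);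
  pf_ru : forall i j (F : B i j),
    fmap (pf i j) (ru F) ∘ pf2 F (one B i) ∘ (idm (pf i j F) ⊛ pf1 i) = ru (pf i j F) }.

(* Biadditivity of horizontal composition follows from bilinearity on
   2-morphisms; the index type [I] is finite. *)
Record finitary_2category (k : closedFieldType) (I : finType) (C : bicat k I) : Prop :=
  Finitary2category {
    f2_strict : is_2category C;
    f2_hom : forall i j, finitary (C i j);
    f2_one : forall i, indecomposable (one C i) }.

(* A weak anti-equivalence for which [F] and its image are adjoint is forced to
   be the identity on objects. *)
Definition weak_anti_equivalence (k : fieldType) (I : Type) (C : bicat k I)
    (st : pseudofunctor C (coop C)) : Prop :=
  forall i j, is_equivalence (st i j).

Record weakly_fiat (k : closedFieldType) (I : finType) (C : bicat k I) : Prop :=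
  WeaklyFiat {
    wf_finitary : finitary_2category C;
    wf_star : exists2 st : pseudofunctor C (coop C), weak_anti_equivalence st &
      forall i j (F : C i j), adjoint_pair F (st i j F : C j i) }.

(* The abelianisation is characterised by these properties up to biequivalence
   under [C]: left exactness determines horizontal composition from its
   restriction to injective objects. *)
Record inj_abelianisation (k : fieldType) (I : Type) (C : bicat k I) :=
  InjAbelianisation {
    ia_bicat :> bicat k I;
    ia_emb : pseudofunctor C ia_bicat;
    ia_abelian : forall i j, abelian (ia_bicat i j);
    ia_enough : forall i j, enough_injectives (ia_bicat i j);
    ia_linear : forall i j, linear_functor (ia_emb i j);
    ia_ff : forall i j, fully_faithful (ia_emb i j);
    ia_inj : forall i j (X : ia_bicat i j),
      is_injective X <-> exists F : C i j, isomorphic X (ia_emb i j F);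
    ia_exactl : forall i j l (G : ia_bicat j l) (F F' F'' : ia_bicat i j)
        (m : hom F' F) (f : hom F F''),
      is_kernel m f -> is_kernel (idm G ⊛ m) (idm G ⊛ f);
    ia_exactr : forall i j l (F : ia_bicat i j) (G G' G'' : ia_bicat j l)
        (m : hom G' G) (f : hom G G''),
      is_kernel m f -> is_kernel (m ⊛ idm F) (f ⊛ idm F);
    ia_zero : forall i j, ia_bicat i j;
    ia_zeroP : forall i j, is_zero (ia_zero i j) }.

(* A formal direct sum of 1-morphisms is encoded as a matrix [X] with
   [X i j : A i j].  The composite of two such has (i, l)-entry the direct sum
   over m of [Y m l ⊙ X i m]; since a morphism into a finite direct sum amounts
   to the family of its components, 2-morphisms into a composite are given
   componentwise and no direct sum has to be chosen.  In particular all
   equations below between morphisms into composites are componentwise, and a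
   2-morphism to the direct sum of the identities is a family of 2-morphisms
   [X i i -> one A i]. *)

Section Comodules.
Variables (k : fieldType) (I : finType) (C0 : bicat k I).
Variable A : inj_abelianisation C0.

Record coalg_data := CoalgData {
  cg :> forall i j, A i j;
  cg_mu : forall i m l, hom (cg i l) (cg m l ⊙ cg i m);
  cg_eps : forall i, hom (cg i i) (one A i) }.

(* [cg_diag] expresses that the underlying 1-morphism is a direct sum of
   1-morphisms in the categories [A i i]. *)
Record is_coalg (D : coalg_data) : Prop := IsCoalg {
  cg_diag : forall i j, i != j -> is_zero (D i j);
  cg_coassoc : forall i m n l,
    asso (D n l) (D m n) (D i m) ∘ (cg_mu D m n l ⊛ idm (D i m)) ∘ cg_mu D i m l =
    (idm (D n l) ⊛ cg_mu D i m n) ∘ cg_mu D i n l;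
  cg_counitl : forall i l,
    lu (D i l) ∘ (cg_eps D l ⊛ idm (D i l)) ∘ cg_mu D i l l = idm (D i l);
  cg_counitr : forall i l,
    ru (D i l) ∘ (idm (D i l) ⊛ cg_eps D i) ∘ cg_mu D i i l = idm (D i l) }.

Record coalg := Coalg { cgd :> coalg_data; cgP : is_coalg cgd }.

Variable C : coalg.

(* [l] is the common target of the components. *)
Record comod (l : I) := Comod {
  cm :> forall i, A i l;
  cm_rho : forall i m, hom (cm i) (cm m ⊙ C i m);
  cm_coassoc : forall i m n,
    asso (cm n) (C m n) (C i m) ∘ (cm_rho m n ⊛ idm (C i m)) ∘ cm_rho i m =
    (idm (cm n) ⊛ cg_mu C i m n) ∘ cm_rho i n;
  cm_counit : forall i,
    ru (cm i) ∘ (idm (cm i) ⊛ cg_eps C i) ∘ cm_rho i i = idm (cm i) }.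

Definition is_comod_hom l (M N : comod l) (f : forall i, hom (M i) (N i)) : Prop :=
  forall i m, cm_rho N i m ∘ f i = (f m ⊛ idm (C i m)) ∘ cm_rho M i m.

Record comod_hom l (M N : comod l) := ComodHom {
  ch : forall i, hom (M i) (N i);
  chP : is_comod_hom ch }.

Lemma comod_hom_eq l (M N : comod l) (f g : comod_hom M N) :
  (forall i, ch f i = ch g i) -> f = g.
Proof.
case: f g => [f Pf] [g Pg] /= e.
have {}e : f = g by apply: functional_extensionality_dep.
by case: g / e Pg => Pg; rewrite (proof_irrelevance _ Pf Pg).
Qed.

Definition comod_id l (M : comod l) : comod_hom M M.
Proof.
by exists (fun i => idm (M i)) => i m; rewrite hcm1 comp1m compm1.
Defined.

Definition comod_comp l (M N P : comod l) (g : comod_hom N P) (f : comod_hom M N) :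
  comod_hom M P.
Proof.
exists (fun i => ch g i ∘ ch f i) => i m.
by rewrite compA chP -compA chP compA hcm_comp_l.
Defined.

Definition comod_cat_at (l : I) : cat.
Proof.
exists (comod l) (@comod_hom l) (@comod_id l) (@comod_comp l).
- by move=> M N f; apply: comod_hom_eq => i; apply: comp1m.
- by move=> M N f; apply: comod_hom_eq => i; apply: compm1.
- by move=> M N P Q h g f; apply: comod_hom_eq => i; apply: compA.
Defined.

(* A right comodule is a matrix, i.e. a family [M] whose column with target [l]
   is a comodule [M l] with target [l]. *)
Definition comod_cat : cat := prod_cat comod_cat_at.

Definition reg_comod : comod_cat :=
  fun l => @Comod l (fun i => C i l) (fun i m => cg_mu C i m l)
    (fun i m n => cg_coassoc (cgP C) i m n l) (fun i => cg_counitr (cgP C) i l).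

Lemma act_coassoc j l (F : A j l) (M : comod j) i m n :
  asso (F ⊙ M n) (C m n) (C i m) ∘
    ((assoV F (M n) (C m n) ∘ (idm F ⊛ cm_rho M m n)) ⊛ idm (C i m)) ∘
    (assoV F (M m) (C i m) ∘ (idm F ⊛ cm_rho M i m)) =
  (idm (F ⊙ M n) ⊛ cg_mu C i m n) ∘
    (assoV F (M n) (C i n) ∘ (idm F ⊛ cm_rho M i n)).
Proof.
have e : (idm (F ⊙ M n) ⊛ cg_mu C i m n) ∘ assoV F (M n) (C i n) =
  assoV F (M n) (C m n ⊙ C i m) ∘ (idm F ⊛ (idm (M n) ⊛ cg_mu C i m n)).
  by rewrite assoV_nat hcm1.
rewrite [RHS]compA e -[RHS]compA -hcm_comp_r -cm_coassoc !hcm_comp_r !compA.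
rewrite -pentagonV hcm_comp_l; congr (_ ∘ _); rewrite -!compA; congr (_ ∘ (_ ∘ _)).
by rewrite assoV_nat.
Qed.

Lemma act_counit j l (F : A j l) (M : comod j) i :
  ru (F ⊙ M i) ∘ (idm (F ⊙ M i) ⊛ cg_eps C i) ∘
    (assoV F (M i) (C i i) ∘ (idm F ⊛ cm_rho M i i)) = idm (F ⊙ M i).
Proof.
rewrite -hcm1 compA -(compA (ru _)) -assoV_nat compA ru_hc -!hcm_comp_r.
by rewrite cm_counit.
Qed.

Definition act j l (F : A j l) (M : comod_cat_at j) : comod_cat_at l :=
  @Comod l (fun i => F ⊙ M i)
    (fun i m => assoV F (M m) (C i m) ∘ (idm F ⊛ cm_rho M i m))
    (act_coassoc F M) (act_counit F M).

Definition act_map j l (F : A j l) (M N : comod_cat_at j) (f : hom M N) :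
  hom (act F M) (act F N).
Proof.
exists (fun i => idm F ⊛ ch f i) => i m; rewrite /act; cbn [cm cm_rho].
rewrite -compA -hcm_comp_r chP hcm_comp_r !compA; congr (_ ∘ _).
exact: assoV_nat.
Defined.

Definition act_map2 j l (F G : A j l) (a : hom F G) (M : comod_cat_at j) :
  hom (act F M) (act G M).
Proof.
exists (fun i => a ⊛ idm (M i)) => i m; rewrite /act; cbn [cm cm_rho].
rewrite -compA -hcm_exch !compA; congr (_ ∘ _).
by rewrite -hcm1 assoV_nat.
Defined.

Definition act_unit (l : I) (M : comod_cat_at l) : hom M (act (one A l) M).
Proof.
exists (fun i => luV (M i)) => i m; rewrite /act; cbn [cm cm_rho].
by rewrite -compA -luV_nat compA assoV_luV.
Defined.

Definition act_comp j l m (F : A l m) (G : A j l) (M : comod_cat_at j) :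
  hom (act F (act G M)) (act (F ⊙ G) M).
Proof.
exists (fun i => assoV F G (M i)) => i n; rewrite /act; cbn [cm cm_rho].
rewrite hcm_comp_r -hcm1 -compA -assoV_nat !compA; congr (_ ∘ _).
apply: (inverse_pair_mono (assoK (F ⊙ G) (M n) (C i n))).
by rewrite !compA asso_asV comp1m pentagonV -compA -hcm_comp_r asso_asV hcm1 compm1.
Defined.

Lemma zero_hom_eq (i j : I) (Y : A i j) (f g : hom (ia_zero A i j) Y) : f = g.
Proof.
have [h [_ uh]] := proj1 (ia_zeroP A i j) Y.
by rewrite -(uh f) // -(uh g).
Qed.

Definition zero_comod (l : I) : comod_cat_at l :=
  @Comod l (fun i => ia_zero A i l) (fun i m => zerom _ _)
    (fun i m n => zero_hom_eq _ _) (fun i => zero_hom_eq _ _).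

Definition concentrated (l : I) (X : comod_cat_at l) : comod_cat := fun l' =>
  match l =P l' with
  | ReflectT e => match e in _ = n return comod_cat_at n with erefl => X end
  | ReflectF _ => zero_comod l'
  end.

(* For [F : A j l] the composites [F ⊙ M i j'] with j' != j are zero, so only
   the column of [M] with target [j] contributes to [FM]. *)
Definition act_total j l (F : A j l) (M : comod_cat) : comod_cat :=
  concentrated (act F (M j)).

(* Since [FN] is concentrated in [l] for [F : A j l], Hom(M, FN) is the space of
   morphisms from [M l] to [act F (N j)]. *)
Record ihom (N M : comod_cat) := Ihom {
  ih :> forall j l, A j l;
  ih_from : forall j l (F : A j l), hom (M l) (act F (N j)) -> hom (ih j l) F;
  ih_to : forall j l (F : A j l), hom (ih j l) F -> hom (M l) (act F (N j));
  ih_fromK : forall j l (F : A j l), cancel (@ih_from j l F) (@ih_to j l F);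
  ih_toK : forall j l (F : A j l), cancel (@ih_to j l F) (@ih_from j l F);
  ih_nat : forall j l (F G : A j l) (a : hom F G) (g : hom (M l) (act F (N j))),
    ih_from (act_map2 a (N j) ∘ g) = a ∘ ih_from g }.

Definition coev (N M : comod_cat) (H : ihom N M) j l : hom (M l) (act (H j l) (N j)) :=
  ih_to (idm (H j l)).

(* [N, f] : [N, M] -> [N, M'] *)
Definition ihom_map (N M M' : comod_cat) (H : ihom N M) (H' : ihom N M')
    (f : hom M M') j l : hom (H j l) (H' j l) :=
  ih_from H (coev H' j l ∘ f l).

(* [f, M] : [N, M] -> [N', M] *)
Definition ihom_premap (N N' M : comod_cat) (H : ihom N M) (H' : ihom N' M)
    (f : hom N' N) j l : hom (H j l) (H' j l) :=
  ih_from H (act_map (H' j l) (f j) ∘ coev H' j l).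

Definition end_coalg (N : comod_cat) (H : ihom N N) : coalg_data :=
  @CoalgData (fun j l => H j l)
    (fun j m l => ih_from H
       (act_comp (H m l) (H j m) (N j) ∘ act_map (H m l) (coev H j m) ∘ coev H m l))
    (fun j => ih_from H (act_unit (N j))).

Definition rho_map (M : comod_cat) j l : hom (M l) (act (M l j) (reg_comod j)).
Proof.
exists (fun i => cm_rho (M l) i j) => i m; rewrite /act; cbn [cm cm_rho].
apply: (inverse_pair_mono (assoK (M l j) (C m j) (C i m))).
by rewrite !compA asso_asV comp1m cm_coassoc.
Defined.

(* The isomorphism [C, M] -> M, corresponding to the coaction M -> MC. *)
Definition ihom_reg (M : comod_cat) (H : ihom reg_comod M) j l : hom (H j l) (M l j) :=
  ih_from H (rho_map M j l).

Record stable_subcat := StableSubcat {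
  ss :> comod_cat -> Prop;
  ss_zero : forall M, is_zero M -> ss M;
  ss_sum : forall M N P, ss M -> ss N -> is_direct_sum M N P -> ss P;
  ss_sub : forall M N (f : hom M N), is_mono f -> ss N -> ss M;
  ss_quot : forall M N (f : hom M N), is_epi f -> ss M -> ss N;
  ss_stable : forall j l (F : C0 j l) M, ss M -> ss (act_total (ia_emb A j l F) M) }.

Definition equiv_subcat (S S' : stable_subcat) : Prop :=
  exists E : functor (fullsub S) (fullsub S'),
    is_equivalence E /\ nat_isomorphic (compF (@incl _ S') E) (@incl _ S).

Record subcoalg_data := SubcoalgData {
  sc :> coalg_data;
  sc_in : forall i j, hom (sc i j) (C i j) }.

Record is_subcoalg (D : subcoalg_data) : Prop := IsSubcoalg {
  sc_coalg : is_coalg D;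
  sc_mono : forall i j, is_mono (sc_in D i j);
  sc_mu : forall i m l,
    cg_mu C i m l ∘ sc_in D i l = (sc_in D m l ⊛ sc_in D i m) ∘ cg_mu D i m l;
  sc_eps : forall i, cg_eps D i = cg_eps C i ∘ sc_in D i i }.

Definition iso_subcoalg (D E : subcoalg_data) : Prop :=
  exists t : forall i j, hom (D i j) (E i j),
    [/\ forall i j, is_iso (t i j),
        forall i m l, cg_mu E i m l ∘ t i l = (t m l ⊛ t i m) ∘ cg_mu D i m l,
        forall i, cg_eps D i = cg_eps E i ∘ t i i &
        forall i j, sc_in D i j = sc_in E i j ∘ t i j].

(* A choice of all the data entering its construction: the right adjoint p of
   the embedding i, the relevant internal homs, and the inverse of
   [i', B] : [C, B] -> [B, B], where B = ip(C) and i' : B -> C is the counit. *)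
Record realisation (S : stable_subcat) := Realisation {
  r_p : functor comod_cat (fullsub S);
  r_adj : adjunction (@incl _ S) r_p;
  r_B : comod_cat := @incl _ S (r_p reg_comod);
  r_i : hom r_B reg_comod := adj_counit r_adj reg_comod;
  r_BB : ihom r_B r_B;
  r_CB : ihom reg_comod r_B;
  r_CC : ihom reg_comod reg_comod;
  r_inv : forall j l, hom (r_BB j l) (r_CB j l);
  r_invP : forall j l, inverse_pair (ihom_premap r_CB r_BB r_i j l) (r_inv j l) }.

Definition ip_subcoalg (S : stable_subcat) (r : realisation S) : subcoalg_data :=
  @SubcoalgData (end_coalg (r_BB r))
    (fun j l => ihom_reg (r_CC r) j l ∘ ihom_map (r_CB r) (r_CC r) (r_i r) j l
                ∘ r_inv r j l).

End Comodules.

(* Main.v *)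
(* Kernels, cokernels and direct sums of comodules are computed componentwise,
   and Hom into the finitely many indecomposable injectives gives a length
   function, so every comodule N has a largest subobject lying in S; this is
   ip(N). Write B = ip(C), with embedding B -> C. As S is closed under sub- and
   quotient objects and under the action of injective 1-morphisms, every
   morphism M -> FC with M in S factors through FB: for injective F because F
   has a left adjoint under which S is stable, for general F by left exactness.
   Hence [B,B] = [C,B] = B, embedded in C as B -> C. Conversely M lies in S if
   and only if its coaction M -> MC factors through MB, which recovers S from
   the subcoalgebra; and for a subcoalgebra D the comodules whose coaction
   factors through MD form a subcategory in which D itself is the largest
   subobject of C. *)
From HB Require Import structures.
From mathcomp Require Import all_boot all_order all_algebra.
From Stdlib Require Import FunctionalExtensionality Classical IndefiniteDescription.
Require Import Defs.

Set Implicit Arguments.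
Unset Strict Implicit.
Unset Printing Implicit Defensive.

Import GRing.Theory.
Local Open Scope ring_scope.
Local Open Scope bicat_scope.

(** * Categories and abelian linear categories *)

(** Kernels, lifts and direct sums are provided by existence statements, one component at a time;
    choice assembles them into families. *)
Lemma dep_choice (T : Type) (U : T -> Type) (P : forall t, U t -> Prop) :
  (forall t, exists u, P t u) -> exists f, forall t, P t (f t).
Proof.
move=> h; exists (fun t => proj1_sig (constructive_indefinite_description _ (h t))).
by move=> t; case: constructive_indefinite_description.
Qed.

Lemma dep_choice2 (T V : Type) (U : T -> V -> Type) (P : forall t v, U t v -> Prop) :
  (forall t v, exists u, P t v u) -> exists f, forall t v, P t v (f t v).
Proof.
move=> h.
exact: (@dep_choice T _ (fun t f => forall v, P t v (f v)) (fun t => dep_choice (h t))).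
Qed.

Section Cat.
Variable X : cat.
Implicit Types x y z w : X.

Lemma mono_comp x y z (g : hom y z) (f : hom x y) :
  is_mono g -> is_mono f -> is_mono (g ∘ f).
Proof. by move=> hg hf w a b; rewrite -!compA => /hg/hf. Qed.

Lemma mono_cancel x y z (g : hom y z) (f : hom x y) : is_mono (g ∘ f) -> is_mono f.
Proof. by move=> h w a b e; apply: h; rewrite -!compA e. Qed.

Lemma iso_mono x y (f : hom x y) : is_iso f -> is_mono f.
Proof. by case=> g hg w a b; apply: inverse_pair_mono hg. Qed.

Lemma iso_epi x y (f : hom x y) : is_iso f -> is_epi f.
Proof. by case=> g hg w a b; apply: inverse_pair_epi hg. Qed.

Lemma iso_idm x : is_iso (idm x).
Proof. by exists (idm x); split; rewrite comp1m. Qed.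

Lemma iso_comp x y z (g : hom y z) (f : hom x y) :
  is_iso g -> is_iso f -> is_iso (g ∘ f).
Proof.
case=> g' [g1 g2] [f' [f1 f2]]; exists (f' ∘ g'); split.
  by rewrite compA -(compA f') g1 compm1.
by rewrite compA -(compA g) f2 compm1.
Qed.

Lemma is_zero_from x y (f g : hom x y) : is_zero x -> f = g.
Proof. by case=> h _; have [u [_ hu]] := h y; rewrite -(hu f) // -(hu g). Qed.

Lemma is_zero_to x y (f g : hom y x) : is_zero x -> f = g.
Proof. by case=> _ h; have [u [_ hu]] := h y; rewrite -(hu f) // -(hu g). Qed.

End Cat.

Section Lin.
Variables (k : fieldType) (A : lincat k).
Implicit Types x y z w : A.

Definition addm x y (f g : hom x y) : hom x y := (f : lhom A x y) + g.
Definition subm x y (f g : hom x y) : hom x y := (f : lhom A x y) - g.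

Lemma comp_addr x y z (h : hom y z) (f g : hom x y) :
  h ∘ addm f g = addm (h ∘ f) (h ∘ g).
Proof.
by have := @lcomp_linr k A x y z h 1 f g; rewrite !scale1r.
Qed.

Lemma comp_addl x y z (f g : hom y z) (h : hom x y) :
  addm f g ∘ h = addm (f ∘ h) (g ∘ h).
Proof.
by have := @lcomp_linl k A x y z h 1 f g; rewrite !scale1r.
Qed.

Lemma submm x y (f : hom x y) : subm f f = zerom x y.
Proof. exact: (subrr (f : lhom A x y)). Qed.

Lemma addm0 x y (f : hom x y) : addm f (zerom x y) = f.
Proof. exact: (addr0 (f : lhom A x y)). Qed.

Lemma add0m x y (f : hom x y) : addm (zerom x y) f = f.
Proof. exact: (add0r (f : lhom A x y)). Qed.

Lemma subm_addK x y (f g : hom x y) : addm (subm f g) g = f.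
Proof. exact: (subrK (g : lhom A x y) f). Qed.

Lemma addm_inj x y (g f f' : hom x y) : addm f g = addm f' g -> f = f'.
Proof. exact: (@addIr (lhom A x y) g). Qed.

Lemma subm_eq0 x y (f g : hom x y) : subm f g = zerom x y -> f = g.
Proof. by move=> e; rewrite -[f](subm_addK f g) e add0m. Qed.

Lemma comp_m0 x y z (h : hom y z) : h ∘ zerom x y = zerom x z.
Proof.
by apply: (@addm_inj _ _ (h ∘ zerom x y)); rewrite -comp_addr addm0 add0m.
Qed.

Lemma comp_0m x y z (h : hom x y) : zerom y z ∘ h = zerom x z.
Proof.
by apply: (@addm_inj _ _ (zerom y z ∘ h)); rewrite -comp_addl addm0 add0m.
Qed.

Lemma comp_subr x y z (h : hom y z) (f g : hom x y) :
  h ∘ subm f g = subm (h ∘ f) (h ∘ g).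
Proof.
by apply: (@addm_inj _ _ (h ∘ g)); rewrite -comp_addr !subm_addK.
Qed.

Lemma comp_subl x y z (f g : hom y z) (h : hom x y) :
  subm f g ∘ h = subm (f ∘ h) (g ∘ h).
Proof.
by apply: (@addm_inj _ _ (g ∘ h)); rewrite -comp_addl !subm_addK.
Qed.

Lemma mono0P x y (f : hom x y) :
  (forall w (g : hom w x), f ∘ g = zerom w y -> g = zerom w x) <-> is_mono f.
Proof.
split=> [h w a b e | h w g e]; last by apply: h; rewrite e comp_m0.
by apply: subm_eq0; apply: h; rewrite comp_subr e submm.
Qed.

Lemma epi0P x y (f : hom x y) :
  (forall w (g : hom y w), g ∘ f = zerom x w -> g = zerom y w) <-> is_epi f.
Proof.
split=> [h w a b e | h w g e]; last by apply: h; rewrite e comp_0m.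
by apply: subm_eq0; apply: h; rewrite comp_subl e submm.
Qed.

Lemma kernel_mono x y z (m : hom z x) (f : hom x y) : is_kernel m f -> is_mono m.
Proof.
case=> e h w a b eab; have [|c [_ hc]] := h w (m ∘ a).
  by rewrite compA e comp_0m.
by rewrite -(hc a) // -(hc b).
Qed.

Lemma cokernel_epi x y z (e : hom y z) (f : hom x y) : is_cokernel e f -> is_epi e.
Proof.
case=> ef h w a b eab; have [|c [_ hc]] := h w (a ∘ e).
  by rewrite -compA ef comp_m0.
by rewrite -(hc a) // -(hc b).
Qed.

Lemma kernel_lift x y z w (m : hom z x) (f : hom x y) (g : hom w x) :
  is_kernel m f -> f ∘ g = zerom w y -> exists h, m ∘ h = g.
Proof. by case=> _ H /H [h [e _]]; exists h. Qed.

Lemma cokernel_desc x y z w (e : hom y z) (f : hom x y) (g : hom y w) :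
  is_cokernel e f -> g ∘ f = zerom x w -> exists h, h ∘ e = g.
Proof. by case=> _ H /H [h [E _]]; exists h. Qed.

Lemma is_zeroP x : is_zero x <-> idm x = zerom x x.
Proof.
split=> [h | e]; first exact: is_zero_from.
split=> y; exists (zerom _ _); split=> // f _.
  by rewrite -[f]compm1 e comp_m0.
by rewrite -[f]comp1m e comp_0m.
Qed.

Lemma mono_to_zero x y (m : hom x y) : is_mono m -> is_zero y -> is_zero x.
Proof. by move=> hm hy; apply/is_zeroP/hm/is_zero_to. Qed.

Lemma coproduct_jointly_epi x y z w (a : hom x z) (b : hom y z) (f g : hom z w) :
  is_coproduct a b -> f ∘ a = g ∘ a -> f ∘ b = g ∘ b -> f = g.
Proof.
by move=> h ea eb; have [c [_ hc]] := h w (f ∘ a) (f ∘ b); rewrite -(hc f) // -(hc g).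
Qed.

Lemma coproduct_proj x y z (a : hom x z) (b : hom y z) :
  is_coproduct a b -> exists (p : hom z x) (q : hom z y),
    [/\ p ∘ a = idm x, p ∘ b = zerom y x, q ∘ a = zerom x y, q ∘ b = idm y &
        addm (a ∘ p) (b ∘ q) = idm z].
Proof.
move=> h; have [p [[pa pb] _]] := h _ (idm x) (zerom y x).
have [q [[qa qb] _]] := h _ (zerom x y) (idm y).
exists p, q; split=> //; apply: coproduct_jointly_epi h _ _; rewrite comp1m comp_addl -!compA.
  by rewrite pa qa compm1 comp_m0 addm0.
by rewrite pb qb compm1 comp_m0 add0m.
Qed.

Hypothesis abA : abelian A.

Lemma mono_epi_iso x y (f : hom x y) : is_mono f -> is_epi f -> is_iso f.
Proof.
move=> hm he; have [z [g hk]] := ab_mono abA hm.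
have eg : g = zerom y z.
  by apply: (proj2 (epi0P f)) => //; case: hk.
have [|h e] := kernel_lift (g := idm y) hk; first by rewrite eg comp_0m.
by exists h; split=> //; apply: hm; rewrite compA e comp1m compm1.
Qed.

(** If [g ∘ e = 0], then [e] factors through the kernel [c] of [g]. The mono [m ∘ c] is the kernel
    of some [g'], which kills [f], hence factors through [q] and kills [m]. So [m] factors through
    [m ∘ c], which makes [c] a split epi and forces [g = 0]. *)
Lemma image_epi x y z u (f : hom x y) (q : hom y z) (m : hom u y) (e : hom x u) :
  is_cokernel q f -> is_kernel m q -> m ∘ e = f -> is_epi e.
Proof.
move=> hq hm ef; apply/epi0P => w g ge.
have [v [c hc]] := ab_ker abA g.
have [e' ee] := kernel_lift hc ge.
have [t [g' hg']] := ab_mono abA (mono_comp (kernel_mono hm) (kernel_mono hc)).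
have g'f : g' ∘ f = zerom x t.
  by rewrite -ef -ee !compA -(compA g'); case: hg' => -> _; rewrite comp_0m.
have [s es] := cokernel_desc hq g'f.
have [|r er] := kernel_lift (g := m) hg'.
  by rewrite -es -compA; case: hm => -> _; rewrite comp_m0.
have cr : c ∘ r = idm u by apply: (kernel_mono hm); rewrite compA er compm1.
by rewrite -[g]compm1 -cr compA; case: hc => -> _; rewrite comp_0m.
Qed.

End Lin.

(** * Exactness of horizontal composition *)

Section Bi.
Variables (k : fieldType) (I : Type) (C : bicat k I) (A : inj_abelianisation C).

Lemma hcm_addl i j l (G G' : A j l) (F F' : A i j) (b b' : hom G G') (a : hom F F') :
  addm b b' ⊛ a = addm (b ⊛ a) (b' ⊛ a).
Proof. by have := @hcm_linl _ _ A _ _ _ _ _ _ _ a 1 b b'; rewrite !scale1r. Qed.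

Lemma hcm_0l i j l (G G' : A j l) (F F' : A i j) (a : hom F F') :
  zerom G G' ⊛ a = zerom _ _.
Proof. by apply: (@addm_inj _ _ _ _ (zerom G G' ⊛ a)); rewrite -hcm_addl addm0 add0m. Qed.

(** In an abelian category every mono is a kernel, and left exactness preserves kernels. *)
Lemma hcm_mono_r i j l (G : A j l) (F F' : A i j) (m : hom F F') :
  is_mono m -> is_mono (idm G ⊛ m).
Proof. by case/(ab_mono (ia_abelian A i j)) => z [f /(ia_exactl G)/kernel_mono]. Qed.

Lemma hcm_mono_l i j l (G G' : A j l) (F : A i j) (m : hom G G') :
  is_mono m -> is_mono (m ⊛ idm F).
Proof. by case/(ab_mono (ia_abelian A j l)) => z [f /(ia_exactr F)/kernel_mono]. Qed.

Lemma hcm_split i j l (G G' : A j l) (F F' : A i j) (b : hom G G') (a : hom F F') :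
  b ⊛ a = (b ⊛ idm F') ∘ (idm G ⊛ a).
Proof. by rewrite -hcmM comp1m compm1. Qed.

Lemma hcm_mono i j l (G G' : A j l) (F F' : A i j) (b : hom G G') (a : hom F F') :
  is_mono b -> is_mono a -> is_mono (b ⊛ a).
Proof.
by move=> hb ha; rewrite hcm_split; apply: mono_comp;
  [apply: hcm_mono_l | apply: hcm_mono_r].
Qed.


End Bi.

(** * Comodules *)

Section Comod.
Variables (k : fieldType) (I : finType) (C0 : bicat k I).
Variables (A : inj_abelianisation C0) (C : coalg A).

Section Quotient.
Variables (l : I) (T : Type) (M : T -> comod C l) (P : forall i, A i l).
Variable q : forall t i, hom (M t i) (P i).
Hypothesis q_epi : forall i (w : A i l) (f g : hom (P i) w),
  (forall t, f ∘ q t i = g ∘ q t i) -> f = g.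
Variable rho : forall i m, hom (P i) (P m ⊙ C i m).
Hypothesis rho_q : forall t i m,
  rho i m ∘ q t i = (q t m ⊛ idm (C i m)) ∘ cm_rho (M t) i m.

(** The comodule axioms descend along a jointly epimorphic family of maps. The index type [T] lets
    one construction serve for cokernels ([unit]) and for direct sums ([bool]). *)
Lemma quot_coassoc i m n :
  asso (P n) (C m n) (C i m) ∘ (rho m n ⊛ idm (C i m)) ∘ rho i m =
  (idm (P n) ⊛ cg_mu C i m n) ∘ rho i n.
Proof.
apply: q_epi => t; rewrite -!compA !rho_q !compA -hcm_exch -(compA (q t n ⊛ _)).
rewrite -cm_coassoc -(compA (asso _ _ _)) -hcm_comp_l rho_q hcm_comp_l !compA.
by rewrite asso_nat hcm1.
Qed.

Lemma quot_counit i : ru (P i) ∘ (idm (P i) ⊛ cg_eps C i) ∘ rho i i = idm (P i).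
Proof.
apply: q_epi => t; rewrite -!compA rho_q comp1m (compA (idm _ ⊛ _)) -hcm_exch !compA.
by rewrite ru_nat -!compA (compA (ru _)) cm_counit compm1.
Qed.

Definition quot_comod : comod C l := Comod quot_coassoc quot_counit.

Definition quot_map t : comod_hom (M t) quot_comod :=
  @ComodHom k I C0 A C l (M t) quot_comod (q t) (rho_q t).

End Quotient.

Section Sub.
Variables (l : I) (M : comod C l) (K : forall i, A i l) (e : forall i, hom (K i) (M i)).
Hypothesis e_mono : forall i, is_mono (e i).
Variable rho : forall i m, hom (K i) (K m ⊙ C i m).
Hypothesis e_rho : forall i m, cm_rho M i m ∘ e i = (e m ⊛ idm (C i m)) ∘ rho i m.

(** The axiom holds after composition with [e n] whiskered on the right, and this stays mono by left
    exactness. *)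
Lemma sub_coassoc i m n :
  asso (K n) (C m n) (C i m) ∘ (rho m n ⊛ idm (C i m)) ∘ rho i m =
  (idm (K n) ⊛ cg_mu C i m n) ∘ rho i n.
Proof.
apply: (hcm_mono_l (F := C m n ⊙ C i m) (@e_mono n)); rewrite !compA hcm_exch -(compA _ (e n ⊛ _)) -e_rho.
rewrite [RHS]compA -cm_coassoc -[RHS]compA e_rho !compA; congr (_ ∘ _).
by rewrite -[RHS]compA -hcm_comp_l e_rho hcm_comp_l compA asso_nat hcm1.
Qed.

Lemma sub_counit i : ru (K i) ∘ (idm (K i) ⊛ cg_eps C i) ∘ rho i i = idm (K i).
Proof.
apply: (@e_mono i); rewrite compm1 !compA -ru_nat -(compA (ru _)) hcm_exch -!compA.
by rewrite -e_rho !compA cm_counit comp1m.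
Qed.

Definition sub_comod : comod C l := Comod sub_coassoc sub_counit.

Definition sub_map : comod_hom sub_comod M :=
  @ComodHom k I C0 A C l sub_comod M e e_rho.

End Sub.

Lemma kernel_comod l (M N : comod C l) (f : comod_hom M N) :
  exists (K : comod C l) (e : comod_hom K M), forall i, is_kernel (ch e i) (ch f i).
Proof.
have [K /dep_choice [e he]] := dep_choice (fun i => ab_ker (ia_abelian A i l) (ch f i)).
(* Left exactness makes [e m ⊛ idm (C i m)] a kernel again, so the coaction of [M] restricts to
   it. *)
have H i m : exists rho, (e m ⊛ idm (C i m)) ∘ rho = cm_rho M i m ∘ e i.
  apply: kernel_lift (ia_exactr (C i m) (he m)) _; rewrite compA -chP -compA.
  by case: (he i) => -> _; rewrite comp_m0.
have [rho hr] := dep_choice2 H.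
have e_mono i := kernel_mono (he i); have e_rho i m := esym (hr i m).
by exists (sub_comod e_mono e_rho), (sub_map e_mono e_rho).
Qed.

Lemma cokernel_comod l (M N : comod C l) (f : comod_hom M N) :
  exists (Q : comod C l) (e : comod_hom N Q), forall i, is_cokernel (ch e i) (ch f i).
Proof.
have [Q /dep_choice [e he]] := dep_choice (fun i => ab_coker (ia_abelian A i l) (ch f i)).
(* By colinearity of [f], the coaction of [N] followed by [e m] whiskered kills [f] and so descends
   along [e i]. *)
have H i m : exists rho, rho ∘ e i = (e m ⊛ idm (C i m)) ∘ cm_rho N i m.
  apply: cokernel_desc (he i) _; rewrite -compA chP compA -hcm_comp_l.
  by case: (he m) => -> _; rewrite hcm_0l comp_0m.
have [rho hr] := dep_choice2 H.
have e_epi i (w : A i l) (g h : hom (Q i) w) : (unit -> g ∘ e i = h ∘ e i) -> g = h.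
  by move=> /(_ tt); apply: (cokernel_epi (he i)).
pose q := quot_map (q := fun _ : unit => e) e_epi (fun _ i m => hr i m).
by exists _, (q tt).
Qed.

Lemma coproduct_comod l (M N : comod C l) :
  exists (P : comod C l) (a : comod_hom M P) (b : comod_hom N P),
    forall i, is_coproduct (ch a i) (ch b i).
Proof.
have [P /dep_choice [a /dep_choice [b h]]] :=
  dep_choice (fun i => proj2 (ab_additive (ia_abelian A i l)) (M i) (N i)).
have H i m : exists rho,
   rho ∘ a i = (a m ⊛ idm (C i m)) ∘ cm_rho M i m /\
   rho ∘ b i = (b m ⊛ idm (C i m)) ∘ cm_rho N i m.
  have [r [hr _]] := h i _ ((a m ⊛ idm (C i m)) ∘ cm_rho M i m)
    ((b m ⊛ idm (C i m)) ∘ cm_rho N i m).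
  by exists r.
have [rho hr] := dep_choice2 H.
pose MN (t : bool) := if t then M else N.
pose q (t : bool) i : hom (MN t i) (P i) := match t with true => a i | false => b i end.
have q_epi i (w : A i l) (f g : hom (P i) w) : (forall t, f ∘ q t i = g ∘ q t i) -> f = g.
  by move=> e; apply: coproduct_jointly_epi (h i) (e true) (e false).
have rho_q t i m : rho i m ∘ q t i = (q t m ⊛ idm (C i m)) ∘ cm_rho (MN t) i m.
  by case: t; have [] := hr i m.
by exists (quot_comod q_epi rho_q), (quot_map q_epi rho_q true), (quot_map q_epi rho_q false).
Qed.

Definition zero_map l (M N : comod C l) : comod_hom M N.
Proof.
by exists (fun i => zerom (M i) (N i)) => i m; rewrite hcm_0l comp_m0 comp_0m.
Defined.

Definition add_map l (M N : comod C l) (f g : comod_hom M N) : comod_hom M N.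
Proof.
exists (fun i => addm (ch f i) (ch g i)) => i m.
by rewrite comp_addr hcm_addl comp_addl !chP.
Defined.

Lemma comod_hom_factor l (M N P : comod C l) (u : comod_hom N P) (f : comod_hom M P)
    (g : forall i, hom (M i) (N i)) :
  (forall i, is_mono (ch u i)) -> (forall i, ch u i ∘ g i = ch f i) ->
  is_comod_hom g.
Proof.
move=> hu e i m; apply: (hcm_mono_l (hu m)).
by rewrite compA -chP -compA e chP -e hcm_comp_l !compA.
Qed.

Lemma comod_hom_desc l (M N P : comod C l) (u : comod_hom M N) (f : comod_hom M P)
    (g : forall i, hom (N i) (P i)) :
  (forall i, is_epi (ch u i)) -> (forall i, g i ∘ ch u i = ch f i) ->
  is_comod_hom g.
Proof.
move=> hu e i m; apply: (hu i).
by rewrite -!compA e (chP u) compA -hcm_comp_l e chP.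
Qed.

(** * Kernels, cokernels, images and direct sums in the category of comodules *)

Local Notation CC := (comod_cat C).

Lemma CC_eq (M N : CC) (f g : hom M N) :
  (forall l i, ch (f l) i = ch (g l) i) -> f = g.
Proof.
by move=> e; apply: functional_extensionality_dep => l; apply: comod_hom_eq.
Qed.

Lemma CC_comp (M N P : CC) (g : hom N P) (f : hom M N) l i :
  ch ((g ∘ f) l) i = ch (g l) i ∘ ch (f l) i.
Proof. by []. Qed.

(** [comod_cat] is a bare category, so the zero morphisms and sums of morphisms used in biproduct
    arguments are supplied by hand. *)
Definition CC0 (M N : CC) : hom M N := fun l => zero_map (M l) (N l).
Lemma CC0E (M N : CC) l i : ch (CC0 M N l) i = zerom (M l i) (N l i).
Proof. by []. Qed.

Definition CCadd (M N : CC) (f g : hom M N) : hom M N := fun l => add_map (f l) (g l).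

Lemma CCaddE (M N : CC) (f g : hom M N) l i :
  ch (CCadd f g l) i = addm (ch (f l) i) (ch (g l) i).
Proof. by []. Qed.

Lemma CC_kernel (M N : CC) (f : hom M N) :
  exists (K : CC) (e : hom K M), forall l i, is_kernel (ch (e l) i) (ch (f l) i).
Proof.
have [K /dep_choice [e h]] := dep_choice (fun l => kernel_comod (f l)).
by exists K, e.
Qed.

Lemma CC_cokernel (M N : CC) (f : hom M N) :
  exists (Q : CC) (e : hom N Q), forall l i, is_cokernel (ch (e l) i) (ch (f l) i).
Proof.
have [K /dep_choice [e h]] := dep_choice (fun l => cokernel_comod (f l)).
by exists K, e.
Qed.

(** Kernels exist and are componentwise. A mono [f] kills the inclusion [e] of its kernel, so [e] is
    zero and every component of [f] has zero kernel. *)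
Lemma CC_monoP (M N : CC) (f : hom M N) :
  is_mono f <-> forall l i, is_mono (ch (f l) i).
Proof.
split=> [h l i | h W a b e].
  have [K [e he]] := CC_kernel f.
  have e0 : e = CC0 K M.
    apply: h; apply: CC_eq => l' i'; rewrite !CC_comp !CC0E comp_m0.
    by case: (he l' i').
  apply/mono0P => w g /(kernel_lift (he l i)) [u <-].
  by rewrite e0 CC0E comp_0m.
by apply: CC_eq => l i; apply: (h l i); rewrite -!CC_comp e.
Qed.

Lemma CC_epiP (M N : CC) (f : hom M N) :
  is_epi f <-> forall l i, is_epi (ch (f l) i).
Proof.
split=> [h l i | h W a b e].
  have [K [e he]] := CC_cokernel f.
  have e0 : e = CC0 N K.
    apply: h; apply: CC_eq => l' i'; rewrite !CC_comp !CC0E comp_0m.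
    by case: (he l' i').
  apply/epi0P => w g /(cokernel_desc (he l i)) [u <-].
  by rewrite e0 CC0E comp_m0.
by apply: CC_eq => l i; apply: (h l i); rewrite -!CC_comp e.
Qed.

Lemma CC_factor (M N P : CC) (u : hom N P) (f : hom M P)
    (g : forall l i, hom (M l i) (N l i)) : is_mono u ->
  (forall l i, ch (u l) i ∘ g l i = ch (f l) i) ->
  exists h : hom M N, u ∘ h = f /\ forall l i, ch (h l) i = g l i.
Proof.
move=> /CC_monoP hu e.
exists (fun l => ComodHom (comod_hom_factor (hu l) (e l))).
by split=> //; apply: CC_eq => l i; rewrite CC_comp; apply: e.
Qed.

Lemma CC_image (M N : CC) (f : hom M N) :
  exists (P : CC) (e : hom M P) (m : hom P N), [/\ is_epi e, is_mono m & m ∘ e = f].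
Proof.
have [Q [q hq]] := CC_cokernel f; have [P [m hm]] := CC_kernel q.
have mm : is_mono m by apply/CC_monoP => l i; apply: kernel_mono (hm l i).
have H l i : exists e, ch (m l) i ∘ e = ch (f l) i.
  by apply: kernel_lift (hm l i) _; case: (hq l i).
have [e0 he0] := dep_choice2 H; have [e [<- ee0]] := CC_factor mm he0.
exists P, e, m; split=> //; apply/CC_epiP => l i.
have E : ch (m l) i ∘ ch (e l) i = ch (f l) i by rewrite ee0 he0.
exact: (image_epi (ia_abelian A i l) (hq l i) (hm l i) E).
Qed.

Lemma CC_coproductW (M N P : CC) (a : hom M P) (b : hom N P) :
  (forall l i, is_coproduct (ch (a l) i) (ch (b l) i)) -> is_coproduct a b.
Proof.
move=> H W f g.
have [h hh] := dep_choice2 (fun l i => H l i _ (ch (f l) i) (ch (g l) i)).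
have hP l : is_comod_hom (h l).
  move=> i m; apply: coproduct_jointly_epi (H l i) _ _; rewrite -!compA chP [RHS]compA -hcm_comp_l.
    have [[E1 _] _] := hh l i; have [[E2 _] _] := hh l m.
    by rewrite E1 E2 chP.
  by have [[_ ->] _] := hh l i; have [[_ ->] _] := hh l m; rewrite chP.
exists (fun l => ComodHom (hP l)); split.
  by split; apply: CC_eq => l i; have [[E1 E2] _] := hh l i.
move=> h' [e1 e2]; apply: CC_eq => l i; have [_ H2] := hh l i; apply: H2.
by rewrite -!CC_comp e1 e2.
Qed.

Lemma CC_coproduct (M N : CC) :
  exists (P : CC) (a : hom M P) (b : hom N P), is_coproduct a b.
Proof.
have [P /dep_choice [a /dep_choice [b h]]] := dep_choice (fun l => coproduct_comod (M l) (N l)).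
by exists P, a, b; apply: CC_coproductW.
Qed.

Lemma CC_coproduct_split (M N P : CC) (a : hom M P) (b : hom N P) :
  is_coproduct a b -> exists (p : hom P M) (q : hom P N),
    [/\ p ∘ a = idm M, p ∘ b = CC0 N M, q ∘ a = CC0 M N, q ∘ b = idm N &
        CCadd (a ∘ p) (b ∘ q) = idm P].
Proof.
move=> h; have [p [[pa pb] _]] := h _ (idm M) (CC0 N M).
have [q [[qa qb] _]] := h _ (CC0 M N) (idm N).
exists p, q; split=> //; have [c [_ hc]] := h _ a b.
rewrite -(hc (idm P)) ?comp1m // -(hc (CCadd _ _)) //.
split; apply: CC_eq => l i; rewrite CC_comp CCaddE comp_addl !CC_comp -!compA -!CC_comp.
  by rewrite pa qa !CC_comp CC0E compm1 comp_m0 addm0.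
by rewrite pb qb !CC_comp CC0E compm1 comp_m0 add0m.
Qed.

Lemma zero_comod_zero l i : is_zero (@zero_comod k I C0 A C l i).
Proof. exact: ia_zeroP. Qed.

Lemma CC_zero (M : CC) : (forall l i, is_zero (M l i)) -> is_zero M.
Proof.
move=> h; split=> W; exists (CC0 _ _); split=> // f _; apply: CC_eq => l i.
  exact: is_zero_from.
exact: is_zero_to.
Qed.

Lemma zero_CC (M : CC) l i : is_zero M -> is_zero (M l i).
Proof.
move=> h; apply/is_zeroP; have := is_zero_from (idm M) (CC0 M M) h.
by move=> /(congr1 (fun f => ch (f l) i)).
Qed.

End Comod.

(** * Length *)

Lemma linear_inj_dim_lt (k : fieldType) (V W : vectType k) (f : V -> W) (w : W) :
  linear f -> injective f -> (forall v, f v <> w) -> (\dim {: V} < \dim {: W})%N.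
Proof.
move=> lf jf hw.
pose fl : {linear V -> W} := HB.pack f (GRing.isLinear.Build _ _ _ _ f lf).
have k0 : lker (linfun fl) == 0%VS.
  by apply/lker0P => u v; rewrite !lfunE => /jf.
rewrite ltnNge; apply/negP => h.
have e : limg (linfun fl) = {: W}%VS.
  by apply/eqP; rewrite eqEdim subvf /= limg_dim_eq // (eqP k0) capv0.
have /memv_imgP [v _] : w \in limg (linfun fl) by rewrite e memvf.
by rewrite lfunE => /esym /hw.
Qed.

Lemma linear_surj_dim (k : fieldType) (V W : vectType k) (f : V -> W) :
  linear f -> (forall w, exists v, f v = w) ->
  (\dim {: W} <= \dim {: V})%N /\
  ((\dim {: V} <= \dim {: W})%N -> injective f).
Proof.
move=> lf sf.
pose fl : {linear V -> W} := HB.pack f (GRing.isLinear.Build _ _ _ _ f lf).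
have im : limg (linfun fl) = {: W}%VS.
  apply/eqP; rewrite eqEsubv subvf /=; apply/subvP => w _; have [v <-] := sf w.
  by have -> : f v = linfun fl v; [rewrite lfunE | rewrite memv_img ?memvf].
have e := limg_ker_dim (linfun fl) {: V}; rewrite im capfv in e.
split=> [|h]; first by rewrite -e leq_addl.
have k0 : lker (linfun fl) == 0%VS.
  by rewrite -dimv_eq0 -leqn0 -(leq_add2r (\dim {: W})) e.
by move=> u v euv; move/lker0P: k0; apply; rewrite !lfunE.
Qed.

Section Length.
Variables (k : fieldType) (B : lincat k) (n : nat) (Y : 'I_n -> B).
Hypothesis abB : abelian B.
Hypothesis Y_inj : forall a, is_injective (Y a).
Hypothesis Y_sep : forall (x z : B) (f : hom x z),
  (forall a (u : hom z (Y a)), u ∘ f = zerom _ _) -> f = zerom x z.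

(** With [Y] a finite separating family of injectives, this behaves as a length: it grows along
    monos, and strictly unless the mono is an isomorphism. *)
Definition len (x : B) : nat := \sum_(a < n) \dim {: lhom B x (Y a)}.

(** Injectivity of [Y a] makes restriction along [m] a surjection of Hom spaces. *)
Lemma precomp_dim (x z : B) (m : hom x z) a : is_mono m ->
  (\dim {: lhom B x (Y a)} <= \dim {: lhom B z (Y a)})%N /\
  ((\dim {: lhom B z (Y a)} <= \dim {: lhom B x (Y a)})%N ->
   injective (fun u : lhom B z (Y a) => lcomp u m)).
Proof.
move=> hm; apply: linear_surj_dim; first exact: lcomp_linl.
by move=> w; apply: (Y_inj (a := a) (m := m) w).
Qed.

Lemma len_mono (x z : B) (m : hom x z) : is_mono m -> (len x <= len z)%N.
Proof. by move=> hm; apply: leq_sum => a _; case: (precomp_dim a hm). Qed.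

(** Each summand of [len] is monotone, so equal totals force equal summands, and every restriction
    map along [m] is then bijective. If [g ∘ m = 0], all [u ∘ g] vanish, hence [g = 0] by
    separation; thus [m] is epi. *)
Lemma len_iso (x z : B) (m : hom x z) : is_mono m -> (len z <= len x)%N -> is_iso m.
Proof.
move=> hm h; apply: (mono_epi_iso abB hm); apply/epi0P => w g gm.
apply: Y_sep => a u.
have le a' := proj1 (precomp_dim a' hm).
have eq_a : \dim {: lhom B x (Y a)} = \dim {: lhom B z (Y a)}.
  apply/eqP; rewrite eqn_leq le /= leqNgt; apply/negP => lt.
  move: h; rewrite leqNgt /len (bigD1 a) //= [X in (_ < X)%N](bigD1 a) //=.
  by rewrite -addSn leq_add // leq_sum.
apply: (proj2 (precomp_dim a hm)); first by rewrite eq_a.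
change (u ∘ g ∘ m = zerom _ _ ∘ m); by rewrite -compA gm comp_m0 comp_0m.
Qed.

End Length.

(** Induction on the dimension of the endomorphism space of [y] replaces a decomposition into
    indecomposables: if [y] is neither zero nor indecomposable, it splits into two nonzero summands
    with smaller endomorphism spaces. *)
Lemma finitary_separating (k : fieldType) (B : lincat k) (n : nat) (Y : 'I_n -> B) :
  (forall x : B, indecomposable x -> exists a, isomorphic x (Y a)) ->
  forall (D : lincat k) (E : functor B D), linear_functor E ->
  forall (y : B) (x : D) (f : hom x (E y)),
  (forall a (u : hom (E y) (E (Y a))), u ∘ f = zerom _ _) -> f = zerom x (E y).
Proof.
move=> hY D E lE y; move: {2}(\dim {: lhom B y y}).+1 (ltnSn (\dim {: lhom B y y})) => d.
elim: d y => // d IH y hd x f hf.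
have Eadd u v (g h : hom u v) : fmap E (addm g h) = addm (fmap E g) (fmap E h).
  by have := lE _ _ 1 g h; rewrite !scale1r.
have E0 u v : fmap E (zerom u v) = zerom _ _.
  by apply: (@addm_inj _ _ _ _ (fmap E (zerom u v))); rewrite -Eadd addm0 add0m.
have [y0 | y0] := classic (is_zero y).
  by rewrite -[f]comp1m -fmap1 (is_zero_from (idm y) (zerom y y) y0) E0 comp_0m.
have [/hY [a [t ht]] | nd] := classic (indecomposable y).
  have [t' [tt' _]] := ht.
  by rewrite -[f]comp1m -fmap1 -tt' fmapM -compA hf comp_m0.
have [z1 [z2 [[a [b ab]] [nz1 nz2]]]] :
    exists z1 z2, is_direct_sum z1 z2 y /\ ~ is_zero z1 /\ ~ is_zero z2.
  apply: NNPP => no; apply: nd; split=> // z1 z2 hz.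
  have [h1|h1] := classic (is_zero z1); first by left.
  have [h2|h2] := classic (is_zero z2); first by right.
  by case: no; exists z1, z2.
have [p [q [pa pb qa qb s]]] := coproduct_proj ab.
(* The map [u ↦ a1 ∘ u ∘ p1] embeds endomorphisms of [z] into those of [y]. It misses the identity,
   which is nonzero on the other summand [z']. *)
have small z z' (a1 : hom z y) (p1 : hom y z) (a2 : hom z' y) (p2 : hom y z') :
    p1 ∘ a1 = idm z -> p2 ∘ a1 = zerom _ _ -> p2 ∘ a2 = idm z' -> ~ is_zero z' ->
    (\dim {: lhom B z z} < \dim {: lhom B y y})%N.
  move=> pa1 pa21 pa2 nz.
  apply: (@linear_inj_dim_lt k _ _ (fun u : hom z z => a1 ∘ (u ∘ p1)) (idm y)).
  - move=> c u v; transitivity (lcomp a1 (c *: lcomp u p1 + lcomp v p1)).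
      by congr (lcomp a1 _); apply: (lcomp_linl p1 c u v).
    exact: lcomp_linr.
  - move=> u v /(congr1 (fun g => p1 ∘ g ∘ a1)).
    by rewrite !compA pa1 !comp1m -!compA pa1 !compm1.
  - move=> u /(congr1 (fun g => p2 ∘ g ∘ a2)); rewrite !compA pa21 !comp_0m compm1 pa2.
    by move/esym/is_zeroP.
have hp : fmap E p ∘ f = zerom _ _.
  apply: IH => [|c u]; last by rewrite compA hf.
  by apply: leq_trans (small _ _ a p b q pa qa qb nz2) _.
have hq : fmap E q ∘ f = zerom _ _.
  apply: IH => [|c u]; last by rewrite compA hf.
  by apply: leq_trans (small _ _ b q a p qb pb pa nz1) _.
rewrite -[f]comp1m -fmap1 -s Eadd !fmapM comp_addl -!compA hp hq !comp_m0.
exact: addm0.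
Qed.

Section LengthA.
Variables (k : closedFieldType) (I : finType) (C : bicat k I).
Hypothesis hC : finitary_2category C.
Variable A : inj_abelianisation C.

Lemma length_exists : exists d : forall i j, A i j -> nat,
  forall i j (x z : A i j) (m : hom x z), is_mono m ->
    (d i j x <= d i j z)%N /\ ((d i j z <= d i j x)%N -> is_iso m).
Proof.
apply: (@dep_choice2 I I (fun i j => A i j -> nat) (fun i j d =>
  forall (x z : A i j) (m : hom x z), is_mono m ->
    (d x <= d z)%N /\ ((d z <= d x)%N -> is_iso m))) => i j.
have [_ _ [n [Y hY]]] := f2_hom hC i j.
pose Y' a := ia_emb A i j (Y a); exists (len Y').
have Y_inj a : is_injective (Y' a).
  by apply/ia_inj; exists (Y a), (idm _); apply: iso_idm.
have Y_sep (x z : A i j) (f : hom x z) :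
    (forall a (u : hom z (Y' a)), u ∘ f = zerom _ _) -> f = zerom x z.
  (* Embedding [z] in an injective, which comes from [C], reduces separation to objects in the image
     of [ia_emb]. *)
  move=> hf; have [w [m [/ia_inj [F [t ht]] hm]]] := ia_enough z.
  have tm : is_mono (t ∘ m) by apply: mono_comp hm; apply: iso_mono.
  apply: tm; rewrite comp_m0.
  apply: (finitary_separating hY (@ia_linear _ _ _ A i j) (f := t ∘ m ∘ f)) => a u.
  by rewrite compA hf.
move=> x z m hm; split; first exact: len_mono Y_inj _ _ m hm.
exact: (len_iso (ia_abelian A i j) Y_inj Y_sep hm).
Qed.

End LengthA.

(** * Right adjoints of injective 1-morphisms *)

Section Adj.
Variables (k : fieldType) (I : Type).

(** The zigzag identity at [G], with the inverse unitor moved to the other side. *)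
Definition right_triangle (B : bicat k I) i j (F : B i j) (G : B j i)
    (eta : hom (one B i) (G ⊙ F)) (eps : hom (F ⊙ G) (one B j)) : Prop :=
  ru G ∘ (idm G ⊛ eps) ∘ asso G F G ∘ (eta ⊛ idm G) = lu G.

Lemma adjoint_pair_triangle (B : bicat k I) i j (F : B i j) (G : B j i) :
  adjoint_pair F G -> exists eta eps, right_triangle (F := F) (G := G) eta eps.
Proof.
case=> eta [eps [_ e]]; exists eta, eps; apply: (inverse_pair_epi (f := luV G) (g := lu G)).
  by have [h1 h2] := luK G; split.
by rewrite e; have [_ ->] := luK G.
Qed.

Lemma pseudofunctor_triangle (B D : bicat k I) (P : pseudofunctor B D)
    i j (F : B i j) (G : B j i) eta eps :
  right_triangle (F := F) (G := G) eta eps ->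
  exists eta' eps', right_triangle (F := P i j F) (G := P j i G) eta' eps'.
Proof.
rewrite /right_triangle => e.
have [psi [_ psiK]] := pf2_iso P G F; have [u [_ uK]] := pf1_iso P j.
(* The images of unit and counit, corrected by the structure isomorphisms of [P]; [psi] and [u]
   invert [pf2] and [pf1]. *)
exists (psi ∘ fmap (P i i) eta ∘ pf1 P i), (u ∘ fmap (P j j) eps ∘ pf2 P F G).
rewrite -(pf_ru P) -!(pf_lu P).
rewrite -(compA _ (idm _ ⊛ pf1 P j)) -hcm_comp_r !compA uK comp1m.
rewrite hcm_comp_r !compA -(compA _ (pf2 P G (one B j))).
rewrite -{1}(fmap1 (P j i)) pf2_nat !compA -(compA _ (pf2 P G _)) -(compA _ (pf2 P G _ ∘ _)).
rewrite -(pf_asso P) -!compA -hcm_comp_l !compA psiK comp1m hcm_comp_l.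
rewrite -[in fmap (P i i) eta ⊛ _](fmap1 (P j i)).
rewrite !compA -(compA _ (pf2 P (G ⊙ F) G)) pf2_nat !compA.
by rewrite -!fmapM e.
Qed.

(** Whiskering with [X] gives a triangle identity for the adjunction between the functors [G ⊙ -]
    and [R ⊙ -]. *)
Lemma whisker_triangle (B : bicat k I) i l j (X : B i j) (G : B l j) (R : B j l) eta eps :
  right_triangle (F := G) (G := R) eta eps ->
  (idm R ⊛ (lu X ∘ (eps ⊛ idm X) ∘ assoV G R X)) ∘ asso R G (R ⊙ X) ∘
    (eta ⊛ idm (R ⊙ X)) = lu (R ⊙ X).
Proof.
move=> e; apply: (inverse_pair_epi (assoK (one B l) R X)).
rewrite lu_hc -e -hcm1 -compA -asso_nat !hcm_comp_r -!compA.
rewrite (compA (asso R G _)) pentagon !compA -(compA _ (idm R ⊛ assoV G R X)).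
rewrite -(hcm_comp_r _ (assoV G R X)) assoV_as hcm1 compm1 -(compA _ _ (asso R (G ⊙ R) X)).
by rewrite -asso_nat compA triangle -!hcm_comp_l.
Qed.

End Adj.

(** An injective [E] comes from some [F] in [C]. The star is an equivalence, so [F] is isomorphic to
    the star of [H F], which is right adjoint to [H F]. Thus [E] has a left adjoint coming from
    [C]. *)
Lemma injective_right_adjoint (k : closedFieldType) (I : finType) (C : bicat k I)
    (hC : weakly_fiat C) (A : inj_abelianisation C) j l (E : A j l) :
  is_injective E -> exists (G : C l j) (R : A j l) eta eps,
    right_triangle (F := ia_emb A l j G) (G := R) eta eps /\ isomorphic R E.
Proof.
move=> /ia_inj [F [t ht]].
have [st wst adj] := wf_star hC.
have [H [_ [s [_ hs]]]] := wst l j.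
have [s' [s1 s2]] := hs F.
have [eta [eps tr]] := adjoint_pair_triangle (adj l j (H F)).
have [eta' [eps' tr']] := pseudofunctor_triangle (ia_emb A) tr.
exists (H F), (ia_emb A j l (st l j (H F))), eta', eps'; split=> //.
have [t' [t1 t2]] := ht.
(* A morphism of [coop C] is a reversed 2-morphism of [C], which the type annotations make
   explicit. *)
exists (t' ∘ fmap (ia_emb A j l) (s' : @hom (C j l) (st l j (H F)) F)).
apply: iso_comp; first by exists t; split.
exists (fmap (ia_emb A j l) (s F : @hom (C j l) F (st l j (H F)))).
by split; rewrite -fmapM -fmap1; congr fmap; [exact: s1 | exact: s2].
Qed.

(** * Largest subobjects in a stable subcategory *)

Section Concentrated.
Variables (k : fieldType) (I : finType) (C0 : bicat k I).
Variables (A : inj_abelianisation C0) (C : coalg A).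
Local Notation CC := (comod_cat C).

Lemma concentrated_iso l (X : comod_cat_at C l) :
  exists (u : hom X (concentrated X l)) (v : hom (concentrated X l) X),
    inverse_pair u v.
Proof.
rewrite /concentrated; case: (l =P l) => [e | []//]; rewrite (eq_irrelevance e (erefl l)).
by exists (idm X), (idm X); split; apply: comp1m.
Qed.

Lemma concentrated_zero l l' (X : comod_cat_at C l) i :
  l' != l -> is_zero (concentrated X l' i).
Proof.
rewrite /concentrated; case: (l =P l') => [e /negP [] | _ _]; first by rewrite e.
exact: zero_comod_zero.
Qed.

Lemma to_concentrated l (X : comod_cat_at C l) (u : hom X (concentrated X l))
    (M : CC) (f : hom (M l) X) :
  exists h : hom M (concentrated X), h l = u ∘ f.
Proof. by exists (dfwith (CC0 M (concentrated X)) (u ∘ f)); rewrite dfwith_in. Qed.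

Lemma from_concentrated l (X : comod_cat_at C l) (v : hom (concentrated X l) X)
    (M : CC) (f : hom X (M l)) :
  exists h : hom (concentrated X) M, h l = f ∘ v.
Proof. by exists (dfwith (CC0 (concentrated X) M) (f ∘ v)); rewrite dfwith_in. Qed.

Lemma comod_iso_ch l (X Y : comod_cat_at C l) (f : hom X Y) i :
  is_iso f -> is_iso (ch f i).
Proof.
case=> g [e1 e2]; exists (ch g i).
by split; [have := congr1 (fun h => ch h i) e1 | have := congr1 (fun h => ch h i) e2].
Qed.

Lemma concentrated_mono l (X Y : comod_cat_at C l) (f : hom X Y) :
  (forall i, is_mono (ch f i)) ->
  exists h : hom (concentrated X) (concentrated Y), is_mono h.
Proof.
move=> hf; have [u [v uv]] := concentrated_iso X; have [u' [v' uv']] := concentrated_iso Y.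
have [h eh] := from_concentrated (M := concentrated Y) v (u' ∘ f).
exists h; apply/CC_monoP => l' i.
have [e | ne] := eqVneq l' l; last first.
  by move=> w a b _; apply: is_zero_to; apply: concentrated_zero.
rewrite {}e eh; apply: mono_comp.
  by apply: mono_comp (hf i); apply/iso_mono/comod_iso_ch; exists v'.
by apply/iso_mono/comod_iso_ch; exists u; case: uv.
Qed.

(** The inverse of [act_unit]; its colinearity is obtained by descent along that isomorphism. *)
Definition act_lu l (M : comod_cat_at C l) : hom (act (one A l) M) M.
Proof.
exists (fun i => lu (M i)).
apply: (comod_hom_desc (u := act_unit M) (f := comod_id M)) => i.
  by apply: iso_epi; exists (lu (M i)); have [h1 h2] := luK (M i).
by have [_] := luK (M i).
Defined.

Definition act_asso j l m (F : A l m) (G : A j l) (M : comod_cat_at C j) :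
  hom (act (F ⊙ G) M) (act F (act G M)).
Proof.
exists (fun i => asso F G (M i)).
apply: (comod_hom_desc (u := act_comp F G M) (f := comod_id (act F (act G M)))) => i.
  by apply: iso_epi; exists (asso F G (M i)); have [h1 h2] := assoK F G (M i).
by have [_] := assoK F G (M i).
Defined.

End Concentrated.

Section Stable.
Variables (k : closedFieldType) (I : finType) (C0 : bicat k I).
Hypothesis hC : weakly_fiat C0.
Variables (A : inj_abelianisation C0) (C : coalg A) (S : stable_subcat C).
Local Notation CC := (comod_cat C).

(** Stability is assumed only for 1-morphisms of [C]. A general [F] embeds in an injective, that is,
    in one from [C] up to isomorphism, and [S] is closed under subobjects. *)
Lemma stable_act j l (F : A j l) (M : CC) : S M -> S (concentrated (act F (M j))).
Proof.
move=> SM; have [E [m [/ia_inj [F' [t ht]] hm]]] := ia_enough F.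
have hf i : is_mono (ch (act_map2 (t ∘ m) (M j)) i).
  by apply: hcm_mono_l; apply: mono_comp hm; apply: iso_mono.
have [h hh] := concentrated_mono hf.
exact: ss_sub hh (ss_stable F' SM).
Qed.

(** The maps [f t] combine into one mono [g] from [M] to a finite direct sum of objects of [S]; the
    sum is built by induction on the list of indices, keeping each [f t] a composite with [g]. *)
Lemma stable_jointly_mono (T : finType) (M : CC) (N : T -> CC) (f : forall t, hom M (N t)) :
  (forall t, S (N t)) ->
  (forall l i (w : A i l) (a b : hom w (M l i)),
     (forall t, ch (f t l) i ∘ a = ch (f t l) i ∘ b) -> a = b) ->
  S M.
Proof.
move=> SN fm.
have [Q [g [SQ hg]]] : exists (Q : CC) (g : hom M Q), S Q /\
    forall t, t \in enum T -> exists h, h ∘ g = f t.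
  elim: (enum T) => [|t s [Q [g [SQ hg]]]].
    exists (fun l => @zero_comod k I C0 A C l), (CC0 _ _); split=> //.
    by apply: ss_zero; apply: CC_zero => l i; apply: zero_comod_zero.
  have [P [a [b ab]]] := CC_coproduct Q (N t).
  have [p [q [pa pb qa qb _]]] := CC_coproduct_split ab.
  exists P, (CCadd (a ∘ g) (b ∘ f t)); split; first by apply: ss_sum SQ (SN t) _; exists a, b.
  move=> t'; rewrite inE => /orP [/eqP -> | /hg [h <-]].
    exists q; apply: CC_eq => l i.
    rewrite CC_comp CCaddE comp_addr !CC_comp !compA -!CC_comp qa qb.
    by rewrite comp1m CC_comp CC0E comp_0m add0m.
  exists (h ∘ p); apply: CC_eq => l i.
  rewrite !CC_comp CCaddE -compA comp_addr !CC_comp !(compA (ch (p l) i)) -!CC_comp pa pb.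
  by rewrite comp1m CC_comp CC0E comp_0m addm0.
apply: (ss_sub (f := g)) SQ; apply/CC_monoP => l i w a b e.
apply: fm => t; have [|h <-] := hg t; first by rewrite mem_enum.
by rewrite CC_comp -!compA e.
Qed.

(* A subobject of maximal length among those in [S] absorbs every morphism from
   [S]: adjoining the image of another one would make it longer. *)
Lemma trace_exists (N : CC) : exists (P : CC) (m : hom P N), [/\ S P, is_mono m &
  forall (M : CC) (f : hom M N), S M -> exists g, m ∘ g = f].
Proof.
have [d hd] := length_exists (wf_finitary hC) A.
pose L (M : CC) := \sum_(p : I * I) d p.2 p.1 (M p.1 p.2).
have L_le (M M' : CC) (m : hom M M') : is_mono m -> (L M <= L M')%N.
  by move=> /CC_monoP hm; apply: leq_sum => p _; case: (hd _ _ _ _ _ (hm p.1 p.2)).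
have L_iso (M M' : CC) (m : hom M M') : is_mono m -> (L M' <= L M)%N ->
    forall l i, is_iso (ch (m l) i).
  move=> /CC_monoP hm h l i; have [_] := hd _ _ _ _ _ (hm l i); apply.
  rewrite leqNgt; apply/negP => lt.
  move: h; rewrite leqNgt /L (bigD1 (l, i)) //= [X in (_ < X)%N](bigD1 (l, i)) //=.
  rewrite -addSn leq_add // leq_sum // => p _.
  by case: (hd _ _ _ _ _ (hm p.1 p.2)).
have start : exists (P : CC) (m : hom P N), S P /\ is_mono m.
  exists (fun l => @zero_comod k I C0 A C l), (CC0 _ _); split.
    by apply: ss_zero; apply: CC_zero => l i; apply: zero_comod_zero.
  by apply/CC_monoP => l i w a b _; apply: is_zero_to; apply: zero_comod_zero.
have [P [m [SP hm]]] := start.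
have [n] := ubnP (L N - L P); elim: n P m SP hm => // n IH P m SP hm hn.
have [max | nmax] := classic (forall (M : CC) (f : hom M N), S M -> exists g, m ∘ g = f).
  by exists P, m.
have [M [f [SM nf]]] : exists (M : CC) (f : hom M N), S M /\ ~ exists g, m ∘ g = f.
  by apply: NNPP => h; case: nmax => M f SM; apply: NNPP => h'; case: h; exists M, f.
have [U [a [b ab]]] := CC_coproduct P M.
have [g [[ga gb] _]] := ab _ m f.
have [Q [e [m' [he hm' em]]]] := CC_image g.
have SQ : S Q by apply: ss_quot he _; apply: ss_sum SP SM _; exists a, b.
have ea : is_mono (e ∘ a) by apply: (@mono_cancel _ _ _ _ m'); rewrite compA em ga.
have [lt | ge] := ltnP (L P) (L Q).
  apply: (IH Q m' SQ hm'); move: hn; rewrite !ltnS; apply: leq_trans.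
  by rewrite ltn_sub2l // (leq_trans lt) // (L_le _ _ m').
(* Otherwise [P] and [Q] have the same length, so [e ∘ a] is invertible and its inverse [v] carries
   the image of [f] back into [P]. *)
case: nf; have /dep_choice2 [v hv] := L_iso _ _ _ ea ge.
have [|h [h1 h2]] := @CC_factor k I C0 A C M P N m f (fun l i => v l i ∘ ch ((e ∘ b) l) i) hm.
  move=> l i; have [_ h2] := hv l i.
  have -> : m = m' ∘ (e ∘ a) by rewrite compA em ga.
  rewrite CC_comp -compA (compA _ (v l i)) h2 comp1m.
  by change (ch ((m' ∘ (e ∘ b)) l) i = ch (f l) i); rewrite compA em gb.
by exists h.
Qed.

(** The right adjoint sends [N] to its largest subobject [P N] in [S]. All equations follow because
    the inclusions [m N] are mono. *)
Lemma adjunction_exists : exists p : functor CC (fullsub S),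
  inhabited (adjunction (@incl _ S) p).
Proof.
have [P /dep_choice [m hm]] := dep_choice trace_exists.
have Sp N : S (P N) by case: (hm N).
have mm N : is_mono (m N) by case: (hm N).
have lft (M N : CC) (f : hom M N) (SM : S M) : {g | m N ∘ g = f}.
  by apply: constructive_indefinite_description; case: (hm N) => _ _; apply.
pose pmap (M N : CC) (f : hom M N) := sval (lft (P M) N (f ∘ m M) (Sp M)).
have pmapE (M N : CC) (f : hom M N) : m N ∘ pmap M N f = f ∘ m M := svalP (lft _ _ _ _).
have pmap1 M : pmap M M (idm M) = idm (P M) by apply: mm; rewrite pmapE comp1m compm1.
have pmapM (M N Q : CC) (g : hom N Q) (f : hom M N) :
    pmap M Q (g ∘ f) = pmap N Q g ∘ pmap M N f.
  by apply: mm; rewrite pmapE compA pmapE -!compA pmapE.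
pose p := @Functor CC (fullsub S) (fun N => exist _ (P N) (Sp N)) pmap pmap1 pmapM.
exists p; constructor.
pose unit (x : fullsub S) : hom x (p (@incl _ S x)) := sval (lft (sval x) (sval x) (idm _) (svalP x)).
have unitE x : m (sval x) ∘ unit x = idm (sval x) := svalP (lft _ _ _ _).
refine (@Adjunction _ _ (@incl _ S) p unit m _ _ _ _).
- move=> x y f; apply: mm.
  change (m (sval y) ∘ (unit y ∘ f) = m (sval y) ∘ (pmap _ _ f ∘ unit x)).
  by rewrite !compA pmapE unitE comp1m -compA unitE compm1.
- by move=> x y f; apply: pmapE.
- by move=> x; apply: unitE.
move=> y; apply: mm.
change (m y ∘ (pmap _ _ (m y) ∘ unit (p y)) = m y ∘ idm (P y)).
by rewrite compA pmapE -compA unitE.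
Qed.

Variables (B : CC) (io : hom B (reg_comod C)).
Hypothesis io_mono : is_mono io.
Hypothesis io_trace : forall (M : CC) (f : hom M (reg_comod C)), S M -> exists g, io ∘ g = f.

(** For injective [E] the factorisation is obtained by adjunction: a map from [M] to [EC] transposes
    to a map from [GM] to [C], where [GM] lies in [S]. A general [F] is then treated as a kernel of
    a map out of an injective. *)
Lemma act_factor j l (F : A j l) (M : CC) (f : hom (M l) (act F (reg_comod C j))) :
  S M -> exists g : hom (M l) (act F (B j)), act_map F (io j) ∘ g = f.
Proof.
move=> SM; have ioc := proj1 (CC_monoP io) io_mono.
have inj_case (E : A j l) (f' : hom (M l) (act E (reg_comod C j))) :
    is_injective E -> exists g : hom (M l) (act E (B j)), act_map E (io j) ∘ g = f'.
  move=> /(injective_right_adjoint hC) [G [R [eta [eps [tr [t [t' [t1 t2]]]]]]]].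
  have [u [v [uv vu]]] := concentrated_iso (act (ia_emb A l j G) (M l)).
  (* The transpose of [f'] under the adjunction between [G] and [R], where [R] is isomorphic to
     [E]. *)
  pose f1 : hom (act (ia_emb A l j G) (M l)) (reg_comod C j) :=
    act_lu (reg_comod C j) ∘ act_map2 eps (reg_comod C j) ∘ act_comp _ R _ ∘
    act_map (ia_emb A l j G) (act_map2 t' _ ∘ f').
  have [h hv] := from_concentrated (M := reg_comod C) v f1.
  have [h' hh'] := io_trace h (ss_stable G SM).
  pose g1 : hom (act (ia_emb A l j G) (M l)) (B j) := h' j ∘ u.
  have g1E i : ch (io j) i ∘ ch g1 i = ch f1 i.
    have -> : f1 = io j ∘ g1 by rewrite /g1 -[LHS]compm1 -uv [LHS]compA -hv -hh' [RHS]compA.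
    by [].
  (* Transposing the factorisation [g1] back; the whiskered triangle identity shows that its
     composite with [io] is [f']. *)
  exists (act_map2 t _ ∘ act_map R g1 ∘ act_asso R _ (M l) ∘ act_map2 eta (M l) ∘ act_unit (M l)).
  apply: comod_hom_eq => i; pose phi := (t' ⊛ idm _) ∘ ch f' i.
  have wt := whisker_triangle (C i j) tr.
  have L : (idm E ⊛ ch (io j) i) ∘ ((t ⊛ idm _) ∘ (idm R ⊛ ch g1 i) ∘
     asso R (ia_emb A l j G) (M l i) ∘ (eta ⊛ idm (M l i)) ∘ luV (M l i)) = ch f' i.
    rewrite !compA -hcm_exch -(compA (t ⊛ _)) -hcm_comp_r g1E.
    have -> : ch f1 i = lu (C i j) ∘ (eps ⊛ idm (C i j)) ∘ assoV _ R (C i j) ∘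
      (idm _ ⊛ phi) by [].
    rewrite (hcm_comp_r R _ (idm _ ⊛ phi)) -!compA (compA (idm R ⊛ (_ ⊛ phi))) -asso_nat.
    rewrite hcm1 -!compA (compA _ (eta ⊛ _)) -hcm_exch -!compA -luV_nat.
    rewrite !compA -2!(compA (t ⊛ _)) wt -(compA (t ⊛ _)).
    have [_ ->] := luK (R ⊙ C i j); rewrite compm1 -hcm_comp_l.
    by rewrite t2 hcm1 comp1m.
  exact: L.
have [E [m [Einj hm]]] := ia_enough F.
have [Z [z mz]] := ab_mono (ia_abelian A j l) hm.
have [g' eg'] := inj_case E (act_map2 m _ ∘ f) Einj.
have g'E i : (idm E ⊛ ch (io j) i) ∘ ch g' i = (m ⊛ idm (C i j)) ∘ ch f i.
  by have := congr1 (fun h => ch h i) eg'.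
(* Here [F] is the kernel of [z], so [FB] is the kernel of [z] acting on [EB]. That [z] kills [g']
   is checked inside [ZC], where [g'] comes from [f]. *)
have H i : exists g, (m ⊛ idm (B j i)) ∘ g = ch g' i.
  apply: kernel_lift (ia_exactr (B j i) mz) _.
  apply: (hcm_mono_r (G := Z) (ioc j i)).
  rewrite comp_m0 compA -hcm_exch -compA g'E compA -hcm_comp_l.
  by have [-> _] := mz; rewrite hcm_0l comp_0m.
have [g hg] := dep_choice H.
have gE i : (idm F ⊛ ch (io j) i) ∘ g i = ch f i.
  apply: (hcm_mono_l (F := C i j) hm).
  by rewrite compA hcm_exch -compA hg g'E.
have gP : @is_comod_hom k I C0 A C l (M l) (act F (B j)) g.
  apply: (comod_hom_factor (u := act_map F (io j)) (f := f)) gE => i.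
  exact: hcm_mono_r (ioc j i).
by exists (@ComodHom _ _ _ _ _ l (M l) (act F (B j)) g gP); apply: comod_hom_eq.
Qed.

End Stable.

(** * Internal homs and the embedding of the endomorphism coalgebra *)

(** After whiskering with the unit, both sides are rewritten by [triangle] and [lu_hc]. It remains
    that [lu] at a product of units is the whiskered [lu], which is naturality. *)
Lemma lu_one (k : fieldType) (I : Type) (B : bicat k I) j : lu (one B j) = ru (one B j).
Proof.
apply: hcm_one_inj; rewrite -triangle -lu_hc; congr (_ ∘ _).
apply: (inverse_pair_mono (luK (one B j))); exact: esym (lu_nat _).
Qed.

Lemma ru_whisker (k : fieldType) (I : Type) (B : bicat k I) i j l
    (G : B j l) (F : B i j) (X : B i i) (a : hom X (one B i)) :
  ru (G ⊙ F) ∘ (idm (G ⊙ F) ⊛ a) ∘ assoV G F X = idm G ⊛ (ru F ∘ (idm F ⊛ a)).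
Proof. by rewrite -hcm1 -compA -assoV_nat compA ru_hc -hcm_comp_r. Qed.

(** * Cofree comodules FC and internal homs out of C *)

Section Cofree.
Variables (k : fieldType) (I : finType) (C0 : bicat k I).
Variables (A : inj_abelianisation C0) (C : coalg A).
Local Notation CC := (comod_cat C).

(** [FC] is the cofree comodule on [F]; this is the adjunct of [g], obtained by applying the counit
    of [C]. *)
Definition cofree_counit j l (F : A j l) (X : comod_cat_at C l)
    (g : hom X (act F (reg_comod C j))) : hom (X j) F :=
  ru F ∘ (idm F ⊛ cg_eps C j) ∘ ch g j.

Lemma cofree_counit_nat j l (F G : A j l) (a : hom F G) (X : comod_cat_at C l)
    (g : hom X (act F (reg_comod C j))) :
  cofree_counit (act_map2 a (reg_comod C j) ∘ g) = a ∘ cofree_counit g.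
Proof.
rewrite /cofree_counit.
have -> : ch (act_map2 a (reg_comod C j) ∘ g) j = (a ⊛ idm (C j j)) ∘ ch g j by [].
by rewrite !compA -(compA (ru G)) -hcm_exch !compA ru_nat.
Qed.

(** Colinearity of [g] moves the coaction of [FC] into place, where the left counit law of [C]
    cancels it. *)
Lemma cofree_counitK j l (F : A j l) (M : CC) (g : hom (M l) (act F (reg_comod C j))) :
  act_map2 (cofree_counit g) (reg_comod C j) ∘ rho_map M j l = g.
Proof.
apply: comod_hom_eq => i.
change ((cofree_counit g ⊛ idm (C i j)) ∘ cm_rho (M l) i j = ch g i).
rewrite /cofree_counit !hcm_comp_l -!compA -(chP g).
have -> : cm_rho (act F (reg_comod C j)) i j =
  assoV F (C j j) (C i j) ∘ (idm F ⊛ cg_mu C i j j) by [].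
have tri : (ru F ⊛ idm (C i j)) ∘ assoV F (one A j) (C i j) = idm F ⊛ lu (C i j).
  by rewrite -triangle -compA asso_asV compm1.
rewrite !compA -(compA (ru F ⊛ _)) -assoV_nat !compA tri -!hcm_comp_r.
by rewrite (cg_counitl (cgP C)) hcm1 comp1m.
Qed.

Lemma cofree_counit_rho j l (M : CC) : cofree_counit (rho_map M j l) = idm (M l j).
Proof. exact: cm_counit. Qed.

(** By the cofree correspondence [M] itself is an internal hom from [C] to [M]. *)
Definition reg_ihom (M : CC) : ihom (reg_comod C) M.
Proof.
refine (@Ihom k I C0 A C (reg_comod C) M (fun j l => M l j)
  (fun j l F g => cofree_counit g)
  (fun j l F a => act_map2 a (reg_comod C j) ∘ rho_map M j l) _ _ _).
- by move=> j l F g; apply: cofree_counitK.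
- by move=> j l F a; rewrite cofree_counit_nat cofree_counit_rho compm1.
- by move=> j l F G a g; apply: cofree_counit_nat.
Defined.

Lemma ih_toE (N M : CC) (H : ihom N M) j l (F : A j l) (a : hom (H j l) F) :
  act_map2 a (N j) ∘ coev H j l = ih_to a.
Proof.
by rewrite -[LHS](ih_fromK H) ih_nat /coev ih_toK compm1.
Qed.

Lemma ihom_reg_iso (M : CC) (H : ihom (reg_comod C) M) j l :
  inverse_pair (ihom_reg H j l) (cofree_counit (coev H j l)).
Proof.
split; last by rewrite -cofree_counit_nat ih_toE (ih_fromK H) cofree_counit_rho.
by rewrite -ih_nat cofree_counitK /coev ih_toK.
Qed.

Lemma act_map_map2 j l (F G : A j l) (a : hom F G) (M N : comod_cat_at C j) (f : hom M N) :
  act_map G f ∘ act_map2 a M = act_map2 a N ∘ act_map F f.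
Proof. by apply: comod_hom_eq => i; apply: esym (hcm_exch _ _). Qed.

Lemma rho_map_nat (M N : CC) (f : hom M N) j l :
  rho_map N j l ∘ f l = act_map2 (ch (f l) j) (reg_comod C j) ∘ rho_map M j l.
Proof. by apply: comod_hom_eq => i; apply: (chP (f l)). Qed.

(** The coalgebra axioms of [D] hold after composition with tensor powers of the inclusion, which
    are mono; off-diagonal components are subobjects of zero. *)
Lemma mono_subcoalg (D : subcoalg_data C) :
  (forall i j, is_mono (sc_in D i j)) ->
  (forall i m l, cg_mu C i m l ∘ sc_in D i l =
     (sc_in D m l ⊛ sc_in D i m) ∘ cg_mu D i m l) ->
  (forall i, cg_eps D i = cg_eps C i ∘ sc_in D i i) ->
  is_subcoalg D.
Proof.
move=> hm hmu heps; split=> //; split.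
- by move=> i j ij; apply: mono_to_zero (hm i j) (cg_diag (cgP C) ij).
- move=> i m n l.
  apply: (hcm_mono (hm n l) (hcm_mono (hm m n) (hm i m))).
  rewrite !compA -asso_nat -!hcmM compm1.
  rewrite -(compA (asso _ _ _)) -hcmM -hmu compm1 -[sc_in D i m in LHS]comp1m hcmM.
  rewrite -hmu -[sc_in D n l in RHS]comp1m hcmM -!compA -!hmu !compA.
  by rewrite (cg_coassoc (cgP C)).
- move=> i l; apply: (hm i l).
  rewrite compm1 !compA -lu_nat -(compA (lu _)) -hcmM comp1m compm1 heps.
  rewrite -[sc_in D i l in LHS]comp1m hcmM -!compA -hmu !compA.
  by rewrite (cg_counitl (cgP C)) comp1m.
- move=> i l; apply: (hm i l).
  rewrite compm1 !compA -ru_nat -(compA (ru _)) -hcmM comp1m compm1 heps.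
  rewrite -[sc_in D i l in LHS]comp1m hcmM -!compA -hmu !compA.
  by rewrite (cg_counitr (cgP C)) comp1m.
Qed.

Lemma mutual_iso_subcoalg (D E : subcoalg_data C) :
  is_subcoalg D -> is_subcoalg E ->
  (forall i j, exists t, sc_in E i j ∘ t = sc_in D i j) ->
  (forall i j, exists t, sc_in D i j ∘ t = sc_in E i j) ->
  iso_subcoalg D E.
Proof.
move=> hD hE /dep_choice2 [t ht] /dep_choice2 [t' ht'].
exists t; split.
- move=> i j; exists (t' i j); split.
    by apply: (sc_mono hD); rewrite compA ht' ht compm1.
  by apply: (sc_mono hE); rewrite compA ht ht' compm1.
- move=> i m l; apply: (hcm_mono (sc_mono hE (i := m) (j := l)) (sc_mono hE (i := i) (j := m))).
  by rewrite !compA -(sc_mu hE) -hcmM !ht -compA ht (sc_mu hD).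
- by move=> i; rewrite (sc_eps hD) (sc_eps hE) -compA ht.
- by move=> i j; rewrite ht.
Qed.

(** * The coalgebra [B,B] and its embedding in C *)

Section Realised.
Variables (B : CC) (io : hom B (reg_comod C)).
Variables (H : ihom B B) (K : ihom (reg_comod C) B).
Variable R : ihom (reg_comod C) (reg_comod C).
Variable inv : forall j l, hom (H j l) (K j l).
Hypothesis invP : forall j l, inverse_pair (ihom_premap K H io j l) (inv j l).
Hypothesis io_mono : is_mono io.

(** The map [io, B] read on [B] itself through the identification of [C, B] with [B]. It is the
    isomorphism along which [B, B] is compared with [B]. *)
Definition psi j l : hom (B l j) (H j l) :=
  cofree_counit (act_map (H j l) (io j) ∘ coev H j l).

Definition end_in j l : hom (H j l) (C j l) :=
  ihom_reg R j l ∘ ihom_map K R io j l ∘ inv j l.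

Lemma premapE j l : ihom_premap K H io j l = psi j l ∘ ihom_reg K j l.
Proof. by rewrite -ih_nat cofree_counitK. Qed.

Lemma psi_iso j l : is_iso (psi j l).
Proof.
have [e1 e2] := ihom_reg_iso K j l.
have -> : psi j l = ihom_premap K H io j l ∘ cofree_counit (coev K j l).
  by rewrite premapE -compA e2 compm1.
apply: iso_comp; first by exists (inv j l).
by exists (ihom_reg K j l).
Qed.

Lemma end_in_psi j l : end_in j l ∘ psi j l = ch (io l) j.
Proof.
have [e1 e2] := ihom_reg_iso K j l.
apply: (inverse_pair_epi (conj e1 e2)).
rewrite -compA -premapE /end_in -!compA; have [-> _] := invP j l; rewrite compm1.
rewrite /ihom_map -ih_nat compA ih_toE (ih_fromK R) rho_map_nat ih_nat.
by [].
Qed.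

Lemma end_in_mono j l : is_mono (end_in j l).
Proof.
have [p [p1 p2]] := psi_iso j l.
have -> : end_in j l = ch (io l) j ∘ p by rewrite -end_in_psi -compA p2 compm1.
apply: mono_comp; first exact: (proj1 (CC_monoP io) io_mono).
by apply: iso_mono; exists (psi j l).
Qed.

(** Both sides are adjuncts of the same iterated coevaluation: the comultiplication of [B, B] is
    defined by it, and [ru_whisker] pulls the outer factor out. *)
Lemma end_mu_psi j m l :
  cg_mu (end_coalg H) j m l ∘ psi j l = (idm (H m l) ⊛ psi j m) ∘ ch (coev H m l) j.
Proof.
rewrite -cofree_counit_nat compA -act_map_map2 -compA ih_toE (ih_fromK H).
set g := _ ∘ _.
have e : ch g j = (idm (H m l ⊙ H j m) ⊛ ch (io j) j) ∘ (assoV _ _ _ ∘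
  (idm (H m l) ⊛ ch (coev H j m) j) ∘ ch (coev H m l) j) by [].
have psiE : psi j m = ru (H j m) ∘ (idm _ ⊛ (cg_eps C j ∘ ch (io j) j)) ∘ ch (coev H j m) j.
  rewrite hcm_comp_r compA -(compA (_ ∘ _)).
  exact: erefl.
rewrite /cofree_counit e psiE.
change (ru (H m l ⊙ H j m) ∘ (idm (H m l ⊙ H j m) ⊛ cg_eps C j) ∘
  ((idm (H m l ⊙ H j m) ⊛ ch (io j) j) ∘ (assoV _ _ _ ∘
   (idm (H m l) ⊛ ch (coev H j m) j) ∘ ch (coev H m l) j)) =
  (idm (H m l) ⊛ (ru (H j m) ∘ (idm (H j m) ⊛ (cg_eps C j ∘ ch (io j) j)) ∘
   ch (coev H j m) j)) ∘ ch (coev H m l) j).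
rewrite !compA -(compA (ru _)) -hcm_comp_r ru_whisker.
by rewrite -(hcm_comp_r (H m l)).
Qed.

(** After composing with the isomorphism [psi], compatibility with the comultiplications becomes
    colinearity of [io]. *)
Lemma end_mu_in j m l :
  cg_mu C j m l ∘ end_in j l = (end_in m l ⊛ end_in j m) ∘ cg_mu (end_coalg H) j m l.
Proof.
apply: (iso_epi (psi_iso j l)).
rewrite -[RHS]compA end_mu_psi [RHS]compA -hcmM end_in_psi compm1 -compA end_in_psi.
rewrite hcm_split -compA.
have -> : (idm (H m l) ⊛ ch (io m) j) ∘ ch (coev H m l) j =
    (psi m l ⊛ idm (C j m)) ∘ cm_rho (B l) j m.
  have := congr1 (fun f => ch f j) (cofree_counitK (act_map (H m l) (io m) ∘ coev H m l)).
  exact: esym.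
rewrite compA -hcm_comp_l end_in_psi.
exact: (chP (io l) j m).
Qed.

Lemma end_eps_in j : cg_eps (end_coalg H) j = cg_eps C j ∘ end_in j j.
Proof.
apply: (iso_epi (psi_iso j j)); rewrite -compA end_in_psi.
rewrite -cofree_counit_nat compA -act_map_map2 -compA ih_toE (ih_fromK H).
set g := _ ∘ _.
have e : ch g j = (idm (one A j) ⊛ ch (io j) j) ∘ luV (B j j) by [].
rewrite /cofree_counit e compA -!compA (compA (_ ⊛ cg_eps C j)) -hcm_comp_r.
rewrite -luV_nat compA -lu_one; have [_ ->] := luK (one A j).
by rewrite comp1m.
Qed.

Lemma end_subcoalg : is_subcoalg (@SubcoalgData _ _ _ _ C (end_coalg H) end_in).
Proof.
apply: mono_subcoalg; [exact: end_in_mono | exact: end_mu_in | exact: end_eps_in].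
Qed.

End Realised.
End Cofree.

(** * Stable subcategories and subcoalgebras *)

Section Factoring.
Variables (k : fieldType) (I : finType) (C0 : bicat k I).
Variables (A : inj_abelianisation C0) (C : coalg A).
Local Notation CC := (comod_cat C).

Section Family.
Variables (D : forall i j, A i j) (s : forall i j, hom (D i j) (C i j)).

(** [D] is a bare family, so that the components of ip(C) and those of a subcoalgebra can both be
    inserted. *)
Definition coacts_through l (X : comod_cat_at C l) : Prop :=
  forall i j, exists h : hom (X i) (X j ⊙ D i j), (idm (X j) ⊛ s i j) ∘ h = cm_rho X i j.

Definition all_coact_through (M : CC) : Prop := forall l, coacts_through (M l).

Hypothesis s_mono : forall i j, is_mono (s i j).

Lemma coacts_through_zero (M : CC) : is_zero M -> all_coact_through M.
Proof.
by move=> h l i j; exists (zerom _ _); apply: is_zero_from; apply: zero_CC.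
Qed.

Lemma coacts_through_sum (M N P : CC) :
  all_coact_through M -> all_coact_through N -> is_direct_sum M N P ->
  all_coact_through P.
Proof.
move=> hM hN [a [b ab]] l i j.
have [p [q [_ _ _ _ e]]] := CC_coproduct_split ab.
have [u hu] := hM l i j; have [v hv] := hN l i j.
exists (addm ((ch (a l) j ⊛ idm _) ∘ u ∘ ch (p l) i) ((ch (b l) j ⊛ idm _) ∘ v ∘ ch (q l) i)).
rewrite comp_addr !compA -!hcm_exch -!(compA (_ ⊛ idm (C i j))) hu hv !compA -!chP.
rewrite -!compA -comp_addr.
have -> : addm (ch (a l) i ∘ ch (p l) i) (ch (b l) i ∘ ch (q l) i) = idm (P l i).
  by have := congr1 (fun f => ch (f l) i) e.
by rewrite compm1.
Qed.

(** By left exactness the intersection of [MC] and [ND] inside [NC] is [MD]: with [M] the kernel of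
    [g], vanishing of [g] on the lifted coaction is tested after the mono into [ZC]. *)
Lemma coacts_through_sub (M N : CC) (f : hom M N) :
  is_mono f -> all_coact_through N -> all_coact_through M.
Proof.
move=> /CC_monoP hf hN l i j; have [u hu] := hN l i j.
have [Z [g hg]] := ab_mono (ia_abelian A j l) (hf l j).
have [|h eh] := kernel_lift (g := u ∘ ch (f l) i) (ia_exactr (D i j) hg).
  apply: (hcm_mono_r (G := Z) (@s_mono i j)).
  rewrite comp_m0 !compA -hcm_exch -!compA (compA _ u) hu chP compA -hcm_comp_l.
  by have [-> _] := hg; rewrite hcm_0l comp_0m.
exists h; apply: (hcm_mono_l (F := C i j) (hf l j)).
by rewrite compA hcm_exch -compA eh compA hu chP.
Qed.

(** The lifted coaction of [M], pushed to [ND], kills the kernel of [f], as is seen in [NC], and so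
    descends to [N]. *)
Lemma coacts_through_quot (M N : CC) (f : hom M N) :
  is_epi f -> all_coact_through M -> all_coact_through N.
Proof.
move=> /CC_epiP hf hM l i j; have [u hu] := hM l i j.
have [Z [g hg]] := ab_epi (ia_abelian A i l) (hf l i).
have [|h eh] := cokernel_desc (g := (ch (f l) j ⊛ idm (D i j)) ∘ u) hg.
  apply: (hcm_mono_r (G := N l j) (@s_mono i j)).
  rewrite comp_m0 !compA -hcm_exch -(compA _ _ u) hu -chP -compA.
  by have [-> _] := hg; rewrite comp_m0.
exists h; apply: (hf l i).
by rewrite -compA eh compA -hcm_exch -compA hu chP.
Qed.

Lemma coacts_through_act j l (F : A j l) (X : comod_cat_at C j) :
  coacts_through X -> coacts_through (act F X).
Proof.
move=> hX i m; have [u hu] := hX i m; exists (assoV F (X m) (D i m) ∘ (idm F ⊛ u)).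
change ((idm (F ⊙ X m) ⊛ s i m) ∘ (assoV F (X m) (D i m) ∘ (idm F ⊛ u)) =
  assoV F (X m) (C i m) ∘ (idm F ⊛ cm_rho X i m)).
by rewrite -hcm1 compA -assoV_nat -compA -hcm_comp_r hu.
Qed.

Lemma coacts_through_concentrated l (X : comod_cat_at C l) :
  coacts_through X -> all_coact_through (concentrated X).
Proof.
move=> hX l'; rewrite /concentrated; case: (l =P l') => [e|_].
  by case: _ / e.
by move=> i j; exists (zerom _ _); apply: is_zero_from; apply: zero_comod_zero.
Qed.

(** Applied to a subcoalgebra, this is the inverse of the assignment. *)
Definition subcat_through : stable_subcat C.
Proof.
exists all_coact_through.
- exact: coacts_through_zero.
- exact: coacts_through_sum.
- exact: coacts_through_sub.
- exact: coacts_through_quot.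
- by move=> j l F M hM; apply/coacts_through_concentrated/coacts_through_act/hM.
Defined.

End Family.

Lemma coacts_through_le (D E : forall i j, A i j) (s : forall i j, hom (D i j) (C i j))
    (t : forall i j, hom (E i j) (C i j)) (M : CC) :
  (forall i j, exists u, t i j ∘ u = s i j) ->
  all_coact_through s M -> all_coact_through t M.
Proof.
move=> st hM l i j; have [u hu] := st i j; have [h hh] := hM l i j.
by exists ((idm _ ⊛ u) ∘ h); rewrite compA -hcm_comp_r hu.
Qed.

Section Trace.
Variables (S : stable_subcat C) (p : functor CC (fullsub S)).
Variable adj : adjunction (@incl _ S) p.
Implicit Types M N : CC.

Lemma adj_counit_mem N : S (@incl _ S (p N)).
Proof. exact: (svalP (p N)). Qed.

Lemma adj_counit_lift M N (f : hom M N) :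
  S M -> exists g : hom M (@incl _ S (p N)), adj_counit adj N ∘ g = f.
Proof.
move=> SM; pose x : fullsub S := exist _ M SM.
suff H (f' : hom (@incl _ S x) N) :
    exists g : hom (@incl _ S x) (@incl _ S (p N)), adj_counit adj N ∘ g = f'.
  exact: (H f).
exists (fmap (@incl _ S) (fmap p f' ∘ adj_unit adj x)).
have e : adj_counit adj N ∘ fmap (@incl _ S) (fmap p f') = f' ∘ adj_counit adj (@incl _ S x).
  exact: (adj_counit_nat adj f').
by rewrite fmapM compA e -compA adj_triangleL compm1.
Qed.

Lemma adj_counit_inj M N (g h : hom M (@incl _ S (p N))) :
  S M -> adj_counit adj N ∘ g = adj_counit adj N ∘ h -> g = h.
Proof.
move=> SM e; pose x : fullsub S := exist _ M SM.
have E (u : hom x (p N)) :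
    u = fmap p (adj_counit adj N ∘ (u : hom (@incl _ S x) _)) ∘ adj_unit adj x.
  have e1 : adj_unit adj (p N) ∘ u = fmap p (fmap (@incl _ S) u) ∘ adj_unit adj x.
    exact: (adj_unit_nat adj u).
  by rewrite fmapM -compA -[X in _ = _ ∘ X]e1 compA adj_triangleR comp1m.
by rewrite (E g) (E h) e.
Qed.

(** The adjunction gives uniqueness only for maps out of objects of [S]. The kernel of the counit is
    such an object, being a subobject of one, so its inclusion is zero. *)
Lemma adj_counit_mono N : is_mono (adj_counit adj N).
Proof.
have [K [e he]] := CC_kernel (adj_counit adj N).
have e0 : e = CC0 _ _.
  have me : is_mono e by apply/CC_monoP => l i; apply: kernel_mono (he l i).
  apply: adj_counit_inj; first by apply: ss_sub me (adj_counit_mem N).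
  apply: CC_eq => l i; rewrite !CC_comp CC0E comp_m0.
  by case: (he l i).
apply/CC_monoP => l i; apply/mono0P => w g /(kernel_lift (he l i)) [h <-].
by rewrite e0 CC0E comp_0m.
Qed.

End Trace.
End Factoring.

Section Realisations.
Variables (k : closedFieldType) (I : finType) (C0 : bicat k I).
Hypothesis hC : weakly_fiat C0.
Variables (A : inj_abelianisation C0) (C : coalg A).
Local Notation CC := (comod_cat C).

(** The internal hom [B, B] is realised on [B] itself. Composition with [io] identifies maps from
    [B] to [FB] with maps from [B] to [FC] by [act_factor], and the cofree correspondence applies.
    With this choice [io, B] is the identity. *)
Lemma realisation_exists (S : stable_subcat C) : inhabited (realisation S).
Proof.
have [p [adj]] := adjunction_exists hC S.
pose B : CC := @incl _ S (p (reg_comod C)).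
pose io : hom B (reg_comod C) := adj_counit adj (reg_comod C).
have io_mono : is_mono io by apply: adj_counit_mono.
have SB : S B := svalP (p (reg_comod C)).
have io_trace (M : CC) (f : hom M (reg_comod C)) : S M -> exists g, io ∘ g = f.
  exact: adj_counit_lift.
have lft j l (F : A j l) (a : hom (B l j) F) : {g : hom (B l) (act F (B j)) |
    act_map F (io j) ∘ g = ih_to (i := reg_ihom B) a}.
  apply: constructive_indefinite_description.
  exact: (act_factor hC io_mono io_trace (ih_to (i := reg_ihom B) a) SB).
pose from j l (F : A j l) (g : hom (B l) (act F (B j))) : hom (B l j) F :=
  ih_from (reg_ihom B) (act_map F (io j) ∘ g).
pose to j l (F : A j l) (a : hom (B l j) F) := sval (lft j l F a).
have toE j l (F : A j l) (a : hom (B l j) F) :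
  act_map F (io j) ∘ to j l F a = ih_to (i := reg_ihom B) a by apply: svalP (lft j l F a).
have inj j l (F : A j l) (g h : hom (B l) (act F (B j))) :
    act_map F (io j) ∘ g = act_map F (io j) ∘ h -> g = h.
  move=> e; apply: comod_hom_eq => i.
  apply: (hcm_mono_r (G := F) (proj1 (CC_monoP io) io_mono j i)).
  exact: (congr1 (fun f => ch f i) e).
have fromK j l F : cancel (from j l F) (to j l F).
  by move=> g; apply: inj; rewrite toE ih_fromK.
have toK j l F : cancel (to j l F) (from j l F).
  by move=> a; rewrite /from toE ih_toK.
have nat j l (F G : A j l) (a : hom F G) (g : hom (B l) (act F (B j))) :
    from j l G (act_map2 a (B j) ∘ g) = a ∘ from j l F g.
  by rewrite /from compA act_map_map2 -compA ih_nat.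
pose BB : ihom B B := @Ihom k I C0 A C B B (fun j l => B l j) from to fromK toK nat.
have e j l : ihom_premap (reg_ihom B) BB io j l = idm (B l j).
  by rewrite /ihom_premap /coev toE ih_toK.
constructor; apply: (@Realisation _ _ _ _ _ S p adj BB (reg_ihom B) (reg_ihom (reg_comod C))
  (fun j l => idm (B l j))) => j l.
by rewrite e; split; apply: comp1m.
Qed.

(** Forwards, [act_factor] is applied to the coaction. Backwards, the lifted coactions are maps from
    [M] to the comodules [MB], which lie in [S]; the counit makes them jointly mono. *)
Lemma mem_trace (S : stable_subcat C) (B : CC) (io : hom B (reg_comod C)) :
  S B -> is_mono io ->
  (forall (M : CC) (f : hom M (reg_comod C)), S M -> exists g, io ∘ g = f) ->
  forall M : CC, S M <-> all_coact_through (fun i j => ch (io j) i) M.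
Proof.
move=> SB io_mono io_trace M; split=> [SM l i j | hM].
  have [g e] := act_factor hC io_mono io_trace (rho_map M j l) SM.
  by exists (ch g i); have := congr1 (fun f => ch f i) e.
pose N (t : I * I) := concentrated (act (M t.1 t.2) (B t.2)).
have hf (t : I * I) : exists f : hom M (N t), forall i : I, exists u,
    (u ∘ ch (f t.1) i = cm_rho (M t.1) i t.2).
  have [h hh] := dep_choice (fun i => hM t.1 i t.2).
  have hP : @is_comod_hom _ _ _ _ _ _ (M t.1) (act (M t.1 t.2) (B t.2)) h.
    apply: (comod_hom_factor (u := act_map (M t.1 t.2) (io t.2)) (f := rho_map M t.2 t.1)) hh => i.
    exact: hcm_mono_r (proj1 (CC_monoP io) io_mono t.2 i).
  have [u [v uv]] := concentrated_iso (act (M t.1 t.2) (B t.2)).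
  pose hh' : hom (M t.1) (act (M t.1 t.2) (B t.2)) := ComodHom hP.
  have [f ef] := to_concentrated u hh'.
  exists f => i; exists ((idm (M t.1 t.2) ⊛ ch (io t.2) i) ∘ ch v i).
  rewrite ef -compA.
  have -> : ch v i ∘ ch (u ∘ hh') i = ch hh' i.
    change (ch (v ∘ (u ∘ hh')) i = ch hh' i); rewrite compA.
    by have [-> _] := uv; rewrite comp1m.
  exact: hh.
have [f hf'] := dep_choice hf.
refine (@stable_jointly_mono _ _ _ _ _ S _ M N f _ _) => [t | l i w a b e].
  exact: stable_act.
(* The diagonal index suffices for component [i], because the counit splits [cm_rho (M l) i i]. *)
have [u hu] := hf' (l, i) i.
have hu' : cm_rho (M l) i i = u ∘ ch (f (l, i) l) i := esym hu.
have ei : ch (f (l, i) l) i ∘ a = ch (f (l, i) l) i ∘ b := e (l, i).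
by rewrite -[a]comp1m -[b]comp1m -(cm_counit (M l) i) hu' -!compA ei.
Qed.

Section One.
Variables (S : stable_subcat C) (r : realisation S).

Lemma r_i_mono : is_mono (r_i r).
Proof. exact: adj_counit_mono. Qed.

Lemma ip_subcoalgP : is_subcoalg (ip_subcoalg r).
Proof. exact: (end_subcoalg (r_CC r) (@r_invP _ _ _ _ _ _ r) r_i_mono). Qed.

Lemma r_i_trace (M : CC) (f : hom M (reg_comod C)) : S M -> exists g, r_i r ∘ g = f.
Proof. exact: adj_counit_lift. Qed.

Lemma ip_subcoalg_in j l : exists t : hom (r_B r l j) (ip_subcoalg r j l),
  is_iso t /\ sc_in (ip_subcoalg r) j l ∘ t = ch (r_i r l) j.
Proof.
exists (psi (r_i r) (r_BB r) j l); split.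
  exact: psi_iso (@r_invP _ _ _ _ _ _ r) j l.
exact: (end_in_psi (r_CC r) (@r_invP _ _ _ _ _ _ r) j l).
Qed.

Lemma mem_ip (M : CC) : S M <-> all_coact_through (sc_in (ip_subcoalg r)) M.
Proof.
have := mem_trace (@adj_counit_mem _ _ _ _ _ S (r_p r) (reg_comod C)) r_i_mono r_i_trace M.
move=> ->; split; apply: coacts_through_le => i j; have [t [[t' [t1 t2]] e]] := ip_subcoalg_in i j.
  by exists t.
by exists t'; rewrite -e -compA t2 compm1.
Qed.

End One.

(** Both subcategories are closed under isomorphism, so an equivalence compatible with the
    inclusions forces them to have the same objects. *)
Lemma equiv_subcatP (S S' : stable_subcat C) :
  equiv_subcat S S' <-> forall M, S M <-> S' M.
Proof.
have iso_closed (U : stable_subcat C) (M N : CC) (f : hom M N) : is_iso f -> U N -> U M.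
  by move=> hf; apply: (ss_sub (f := f)); apply: iso_mono.
split=> [[E [[G [_ [s [_ hs]]]] [t [_ ht]]]] M | h].
  split=> SM.
    pose x : fullsub S := exist _ M SM.
    have [g [g1 g2]] := ht x.
    apply: (iso_closed S' M _ g); last exact: (svalP (E x)).
    by exists (t x).
  pose y : fullsub S' := exist _ M SM.
  have [v [v1 v2]] := hs y; have [w [w1 w2]] := ht (G y).
  pose v' : hom M (sval (E (G y))) := v.
  apply: (iso_closed S M (sval (G y)) ((t (G y) : hom (sval (E (G y))) (sval (G y))) ∘ v')).
    by apply: iso_comp; [exists w | exists (s y : hom (sval (E (G y))) M)].
  exact: (svalP (G y)).
pose E := @Functor (fullsub S) (fullsub S')
  (fun x => exist _ (sval x) (proj1 (h (sval x)) (svalP x)))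
  (fun x y f => f) (fun x => erefl) (fun x y z g f => erefl).
pose G := @Functor (fullsub S') (fullsub S)
  (fun x => exist _ (sval x) (proj2 (h (sval x)) (svalP x)))
  (fun x y f => f) (fun x => erefl) (fun x y z g f => erefl).
have nat (x y : CC) (f : hom x y) : idm y ∘ f = f ∘ idm x by rewrite comp1m compm1.
have id_id (x : CC) : idm x ∘ idm x = idm x by apply: comp1m.
exists E; split.
  exists G; split.
    exists (fun x => idm (sval x)); split=> [x y f | x]; first exact: nat f.
    by exists (idm (sval x)); split; exact: (id_id (sval x)).
  exists (fun x => idm (sval x)); split=> [x y f | x]; first exact: nat f.
  by exists (idm (sval x)); split; exact: (id_id (sval x)).
exists (fun x => idm (sval x)); split=> [x y f | x]; first exact: nat f.
by exists (idm (sval x)); split; exact: (id_id (sval x)).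
Qed.

Lemma ip_subcoalg_le (S S' : stable_subcat C) (r : realisation S) (r' : realisation S') :
  (forall M, S M -> S' M) -> forall i j, exists t,
  sc_in (ip_subcoalg r') i j ∘ t = sc_in (ip_subcoalg r) i j.
Proof.
move=> le i j; have [g e] := r_i_trace r' (r_i r) (le _ (adj_counit_mem _ _)).
have [t [[t' [t1 t2]] et]] := ip_subcoalg_in r i j.
have [u [_ eu]] := ip_subcoalg_in r' i j.
have ej : ch (r_i r' j) i ∘ ch (g j) i = ch (r_i r j) i := congr1 (fun f => ch (f j) i) e.
by exists (u ∘ ch (g j) i ∘ t'); rewrite !compA eu ej -et -compA t2 compm1.
Qed.

Lemma equiv_iso (S S' : stable_subcat C) (r : realisation S) (r' : realisation S') :
  equiv_subcat S S' <-> iso_subcoalg (ip_subcoalg r) (ip_subcoalg r').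
Proof.
rewrite equiv_subcatP; split=> [h | [t [ht _ _ et]] M].
  apply: mutual_iso_subcoalg; try exact: ip_subcoalgP.
    by apply: ip_subcoalg_le => M /h.
  by apply: ip_subcoalg_le => M /h.
rewrite (mem_ip r) (mem_ip r'); split; apply: coacts_through_le => i j.
  by exists (t i j); rewrite et.
by have [t' [_ t2]] := ht i j; exists t'; rewrite et -compA t2 compm1.
Qed.

(** * Every subcoalgebra is attained *)

Section Subcoalgebra.
Variables (D : subcoalg_data C) (hD : is_subcoalg D).

(** The comultiplication of [D] with its inner factor included in [C]; it makes [D] a right
    subcomodule of [C]. *)
Let rho l i m : hom (D i l) (D m l ⊙ C i m) := (idm (D m l) ⊛ sc_in D i m) ∘ cg_mu D i m l.

Lemma subcoalg_rho l i m :
  cm_rho (reg_comod C l) i m ∘ sc_in D i l = (sc_in D m l ⊛ idm (C i m)) ∘ rho l i m.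
Proof. by rewrite /rho compA -hcm_split; apply: (sc_mu hD). Qed.

Definition subcoalg_comod : CC :=
  fun l => @sub_comod _ _ _ _ C l (reg_comod C l) (fun i => D i l) (fun i => sc_in D i l)
    (fun i => @sc_mono _ _ _ _ _ _ hD i l) (rho l) (subcoalg_rho l).

Definition subcoalg_map : hom subcoalg_comod (reg_comod C) :=
  fun l => @sub_map _ _ _ _ C l (reg_comod C l) (fun i => D i l) (fun i => sc_in D i l)
    (fun i => @sc_mono _ _ _ _ _ _ hD i l) (rho l) (subcoalg_rho l).

Lemma subcoalg_comod_mem : all_coact_through (sc_in D) subcoalg_comod.
Proof. by move=> l i j; exists (cg_mu D i j l). Qed.

(** The counit law recovers [f] as the coaction of [M] followed by the counit of [C] composed with
    [f] on the left factor. Replacing the coaction by its lift to [MD] lands in [D]. *)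
Lemma subcoalg_absorbs (M : CC) (f : hom M (reg_comod C)) l i :
  all_coact_through (sc_in D) M -> exists g, sc_in D i l ∘ g = ch (f l) i.
Proof.
move=> hM; have [h hh] := hM l i l.
exists (lu (D i l) ∘ ((cg_eps C l ∘ ch (f l) l) ⊛ idm (D i l)) ∘ h).
rewrite !compA -lu_nat -(compA (lu _)) -hcm_exch compA -(compA _ _ h) hh.
have e : lu (C i l) ∘ (cg_eps C l ⊛ idm (C i l)) ∘
    ((ch (f l) l ⊛ idm (C i l)) ∘ cm_rho (M l) i l) = ch (f l) i.
  transitivity (lu (C i l) ∘ (cg_eps C l ⊛ idm (C i l)) ∘ (cg_mu C i l l ∘ ch (f l) i)).
    by congr (_ ∘ _); exact: esym (chP (f l) i l).
  by rewrite compA (cg_counitl (cgP C)) comp1m.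
by rewrite hcm_comp_l -[RHS]e !compA.
Qed.

Lemma subcoalg_realised : exists (S : stable_subcat C) (r : realisation S),
  iso_subcoalg (ip_subcoalg r) D.
Proof.
pose S := subcat_through (sc_mono hD); have [r] := realisation_exists S.
exists S, r; apply: mutual_iso_subcoalg; [exact: ip_subcoalgP | exact: hD | | ] => i j.
  have [t [[t' [t1 t2]] e]] := ip_subcoalg_in r i j.
  have [g eg] := subcoalg_absorbs (r_i r) j i (svalP (r_p r (reg_comod C))).
  by exists (g ∘ t'); rewrite compA eg -e -compA t2 compm1.
have [t [_ e]] := ip_subcoalg_in r i j.
have [g eg] := r_i_trace r subcoalg_map subcoalg_comod_mem.
exists (t ∘ ch (g j) i); rewrite compA e.
exact: (congr1 (fun f => ch (f j) i) eg).
Qed.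

End Subcoalgebra.
End Realisations.

(** The four clauses are existence of the data, values among subcoalgebras, well-definedness
    together with injectivity, and surjectivity. Taking [S' = S] in the third clause shows
    independence of the choices in a realisation. *)
Theorem proposition9 (k : closedFieldType) (I : finType) (C : bicat k I)
    (hC : weakly_fiat C) (A : inj_abelianisation C) (G : coalg A) :
  (forall S : stable_subcat G, inhabited (realisation S)) /\
  (forall (S : stable_subcat G) (r : realisation S), is_subcoalg (ip_subcoalg r)) /\
  (forall (S S' : stable_subcat G) (r : realisation S) (r' : realisation S'),
     equiv_subcat S S' <-> iso_subcoalg (ip_subcoalg r) (ip_subcoalg r')) /\
  (forall D : subcoalg_data G, is_subcoalg D ->
     exists (S : stable_subcat G) (r : realisation S), iso_subcoalg (ip_subcoalg r) D).
Proof.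
split; first exact: realisation_exists hC A G.
split; first by move=> S r; apply: ip_subcoalgP.
split; first by move=> S S' r r'; apply: equiv_iso hC _ _ _ _ _ _.
by move=> D hD; apply: subcoalg_realised hC _ _ _ hD.
Qed.
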